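(* Let $q$ be a power of an odd prime with $q\equiv 1\pmod 4$, let $g$ be a primitive element of $\mathbb F_q$ (a generator of $\mathbb F_q^*$), let $d=4k-1$ with $k$ a positive integer, and let $S_g=\{x\in\mathbb F_q^d: x_1^2+\cdots+x_d^2=g\}$. Then \[R^*_{S_g}\left(\frac{4d}{3d-2}\to 4\right)\ll 1.\]
   Context: $\chi$ is a fixed nontrivial additive character of $\mathbb F_q$. For $V\subset\mathbb F_q^d$ and $f:V\to\mathbb C$, $(fd\sigma)^\vee(m)=\frac{1}{|V|}\sum_{x\in V}\chi(m\cdot x)f(x)$, $\|F\|_{L^r(\mathbb F_q^d,dc)}=(\sum_{m\in\mathbb F_q^d}|F(m)|^r)^{1/r}$, $\|f\|_{L^p(V,d\sigma)}=(\frac1{|V|}\sum_{x\in V}|f(x)|^p)^{1/p}$, and $R_V^*(p\to r)$ is the smallest constant such that $\|(fd\sigma)^\vee\|_{L^r(\mathbb F_q^d,dc)}\le R_V^*(p\to r)\|f\|_{L^p(V,d\sigma)}$ for all $f$. $X\ll 1$ means bounded by a constant independent of $q$. *)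

(* Defs.v *)
From HB Require Import structures.
From mathcomp Require Import all_boot all_order all_algebra all_field.
From mathcomp Require Import all_classical all_reals all_analysis.
From mathcomp Require Import complex.
Set Implicit Arguments. Unset Strict Implicit. Unset Printing Implicit Defensive.
Import Order.TTheory GRing.Theory Num.Theory.
Local Open Scope ring_scope.

Definition cabs (R : realType) (z : R[i]) : R :=
  Num.sqrt (complex.Re z ^+ 2 + complex.Im z ^+ 2).

Definition nontrivial_additive_character (F : finFieldType) (R : realType)
  (chi : F -> R[i]) : Prop :=
  (forall x y : F, chi (x + y) = chi x * chi y) /\ exists x : F, chi x != 1.

Definition dotF (F : finFieldType) (d : nat) (m x : 'rV[F]_d) : F :=
  \sum_(i < d) m 0 i * x 0 i.

Definition ext_op (F : finFieldType) (R : realType) (d : nat)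
  (chi : F -> R[i]) (V : {set 'rV[F]_d}) (f : 'rV[F]_d -> R[i])
  (m : 'rV[F]_d) : R[i] :=
  (#|V|%:R)^-1 * \sum_(x in V) chi (dotF m x) * f x.

Definition norm_dc (F : finFieldType) (R : realType) (d : nat) (r : R)
  (G : 'rV[F]_d -> R[i]) : R :=
  (\sum_(m : 'rV[F]_d) cabs (G m) `^ r) `^ r^-1.

Definition norm_dsigma (F : finFieldType) (R : realType) (d : nat) (p : R)
  (V : {set 'rV[F]_d}) (f : 'rV[F]_d -> R[i]) : R :=
  ((#|V|%:R)^-1 * \sum_(x in V) cabs (f x) `^ p) `^ p^-1.

(* "R_V^*(p -> r) <= C": the constant C is admissible in the extension
   inequality, i.e. the smallest such constant is at most C. *)
Definition extension_bound (F : finFieldType) (R : realType) (d : nat)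
  (chi : F -> R[i]) (V : {set 'rV[F]_d}) (p r C : R) : Prop :=
  forall f : 'rV[F]_d -> R[i],
    norm_dc r (ext_op chi V f) <= C * norm_dsigma p V f.

Definition sphere (F : finFieldType) (d : nat) (g : F) : {set 'rV[F]_d} :=
  [set x : 'rV[F]_d | \sum_(i < d) x 0 i ^+ 2 == g].

(* Main.v *)
Require Import Defs.
From HB Require Import structures.
From mathcomp Require Import all_boot all_order all_algebra all_fingroup all_field.
From mathcomp Require Import all_classical all_reals all_analysis.
From mathcomp Require Import complex ring lra zify.
Import Order.TTheory GRing.Theory Num.Theory.
Local Open Scope ring_scope.
Set Implicit Arguments. Unset Strict Implicit.

(* By Plancherel, the fourth power of the L^4 norm of the extension of f is
   q^d / |S|^4 times the energy sum f(x) f(y) f(z) f(w) over x + y = z + w in S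
   (for f >= 0), a sum over rectangles with sides u = x - z and v = y - z,
   because x, y, z, w in S forces u . v = 0. Put T = q^((d-2)/2).

   Rectangles are sorted by the isotropy of their sides. If neither side is
   isotropic, then for fixed z each line through z carries at most one
   admissible x, and counting orthogonal pairs of projective points costs
   (sum h)^2 / q + T sum h^2. If both are isotropic, they lie in the hyperplane
   orthogonal to z, on which the form is elliptic because z . z = g is not a
   square: positivity of a sum of |h^|^2 over the isotropic cone gives the same
   bound. If only u is isotropic, fix v instead: both z and x lie in a section
   of S by a hyperplane orthogonal to v, so that (z, x) is again an orthogonal
   pair of projective points after a translation, except when v . v = 4 g, in
   which case the hyperplane is elliptic.

   For the exponent p = 4d / (3d - 2), the smallest of the four values at a
   rectangle is interpolated between the other three, which reduces the energy
   to sum f^p ((sum f^(2-p/2))^2 / q + T sum f^(4-p)). Splitting f at the height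
   l with T l^p = sum f^p then gives the endpoint without logarithms. *)

(** * The bilinear form on row vectors *)

Section DotProduct.
Variables (F : finFieldType) (d : nat).
Implicit Types (x y z : 'rV[F]_d) (a : F).

Lemma dotFC x y : dotF x y = dotF y x.
Proof. by apply: eq_bigr => i _; rewrite mulrC. Qed.

Lemma dotFDl x y z : dotF (x + y) z = dotF x z + dotF y z.
Proof. by rewrite -big_split; apply: eq_bigr => i _; rewrite mxE mulrDl. Qed.

Lemma dotFZl a x z : dotF (a *: x) z = a * dotF x z.
Proof. by rewrite [RHS]mulr_sumr; apply: eq_bigr => i _; rewrite mxE mulrA. Qed.

Lemma dotFNl x z : dotF (- x) z = - dotF x z.
Proof. by rewrite -scaleN1r dotFZl mulN1r. Qed.

Lemma dotFDr x y z : dotF z (x + y) = dotF z x + dotF z y.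
Proof. by rewrite dotFC dotFDl !(dotFC z). Qed.

Lemma dotFZr a x z : dotF z (a *: x) = a * dotF z x.
Proof. by rewrite dotFC dotFZl (dotFC z). Qed.

Lemma dotFNr x z : dotF z (- x) = - dotF z x.
Proof. by rewrite dotFC dotFNl (dotFC z). Qed.

Lemma dotF0l x : dotF 0 x = 0.
Proof. by rewrite -(scale0r 0) dotFZl mul0r. Qed.

Lemma dotF_delta x i : dotF (delta_mx 0 i) x = x 0 i.
Proof.
rewrite /dotF (bigD1 i) //= mxE !eqxx mul1r big1 ?addr0 // => j ji.
by rewrite mxE eqxx (negbTE ji) mul0r.
Qed.

Definition dotFE := (dotFDl, dotFDr, dotFNl, dotFNr, dotFZl, dotFZr).

Lemma in_sphere g x : (x \in sphere d g) = (dotF x x == g).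
Proof. by rewrite inE; congr (_ == _); apply: eq_bigr => i _; rewrite expr2. Qed.

End DotProduct.

(** * Additive characters and their orthogonality *)

Section Character.
Variables (F : finFieldType) (C : numClosedFieldType) (chi : F -> C).
Hypothesis chiD : forall x y, chi (x + y) = chi x * chi y.
Hypothesis chi0 : chi 0 = 1.
Hypothesis chi_neq1 : exists x, chi x != 1.
Local Notation q := (#|F|%:R : C).

Lemma chi_neq0 x : chi x != 0.
Proof.
apply/eqP => cx0; have := chiD x (- x); rewrite subrr chi0 cx0 mul0r.
by move/eqP; rewrite oner_eq0.
Qed.

Lemma chiN x : chi (- x) = (chi x)^-1.
Proof. by apply: (mulfI (chi_neq0 x)); rewrite -chiD subrr chi0 divff ?chi_neq0. Qed.

(** Adding [x] to itself [#|F|] times gives 0, so [chi x] is a root of unity. *)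
Lemma chi_norm x : `|chi x| = 1.
Proof.
have chiMn n : chi (x *+ n) = chi x ^+ n.
  by elim: n => [|n IHn]; rewrite ?mulr0n ?expr0 // mulrS exprS chiD IHn.
have xq0 : x *+ #|F| = 0.
  by have := @cyclic.expg_cardG F [set: F]%G x (finset.in_setT x); rewrite FinRing.zmodXgE cardsT.
have := chiMn #|F|; rewrite xq0 chi0 => /(congr1 Num.norm).
rewrite normrX normr1 => /esym /eqP.
by rewrite pexpr_eq1 ?(ltn_trans _ (finNzRing_gt1 F)) // => /eqP.
Qed.

Lemma chi_conj x : (chi x)^* = chi (- x).
Proof.
by apply: (mulfI (chi_neq0 x)); rewrite -normCK chi_norm expr1n chiN divff ?chi_neq0.
Qed.

(** Translation by [y] multiplies the sum by [psi y]. The group is arbitrary so that both scalars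
    and row vectors are covered. *)
Lemma sum_additive_char (V : finZmodType) (psi : V -> C) :
  {morph psi : x y / x + y >-> x * y} ->
  \sum_x psi x = if [exists x, psi x != 1] then 0 else #|V|%:R.
Proof.
move=> psiD; case: existsP => [[y psiy]|psi1].
  have: psi y * (\sum_x psi x) = \sum_x psi x.
    rewrite mulr_sumr [RHS](reindex_inj (addrI y)).
    by apply: eq_bigr => x _; rewrite psiD.
  move/eqP; rewrite -subr_eq0 -{2}[\sum_x _]mul1r -mulrBl mulf_eq0 subr_eq0.
  by rewrite (negbTE psiy) => /eqP.
rewrite -sum1_card natr_sum; apply: eq_bigr => x _.
by apply/eqP/negPn/negP => psix; apply: psi1; exists x.
Qed.

Lemma sum_chi_mul a : \sum_t chi (t * a) = q * (a == 0)%:R.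
Proof.
rewrite sum_additive_char => [|x y]; last by rewrite mulrDl chiD.
case: eqP => [->|/eqP a0]; first by rewrite (introF existsP) ?mulr1 // => -[x]; rewrite mulr0 chi0 eqxx.
have [x chix] := chi_neq1.
by rewrite (introT existsP) ?mulr0 //; exists (x / a); rewrite divfK.
Qed.

Lemma sum_chi_unit a : \sum_(t | t != 0) chi (t * a) = q * (a == 0)%:R - 1.
Proof. by rewrite -sum_chi_mul [in RHS](bigD1 0) //= mul0r chi0 addrC addrK. Qed.

Section RowVectors.
Variable d : nat.

Lemma sum_chi_dot (x : 'rV[F]_d) : \sum_m chi (dotF m x) = q ^+ d * (x == 0)%:R.
Proof.
rewrite sum_additive_char => [|y z]; last by rewrite dotFDl chiD.
have -> : #|'rV[F]_d|%:R = q ^+ d by rewrite card_mx mul1n natrX.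
case: eqP => [->|/eqP x0].
  rewrite (introF existsP) ?mulr1 // => -[y].
  by rewrite dotFC dotF0l chi0 eqxx.
have [i xi] : exists i, x 0 i != 0.
  apply/existsP; apply: contraR x0 => /existsPn x0; apply/eqP/rowP => i.
  by rewrite mxE; apply/eqP/negPn.
have [t chit] := chi_neq1.
rewrite (introT existsP) ?mulr0 //; exists ((t / x 0 i) *: delta_mx 0 i).
by rewrite dotFZl dotF_delta divfK.
Qed.

Lemma sum_rV_prod (h : F -> C) :
  \sum_(x : 'rV[F]_d) \prod_i h (x 0 i) = (\sum_a h a) ^+ d.
Proof.
transitivity (\prod_(i < d) \sum_a h a); last by rewrite prodr_const card_ord.
rewrite bigA_distr_bigA /= (reindex (fun f : {ffun 'I_d -> F} => \row_i f i)) /=.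
  by apply: eq_bigr => f _; apply: eq_bigr => i _; rewrite mxE.
exists (fun x : 'rV[F]_d => [ffun i => x 0 i]) => [f _|x _].
  by apply/ffunP => i; rewrite ffunE mxE.
by apply/rowP => i; rewrite mxE ffunE.
Qed.

Lemma chi_sum (I : finType) (h : I -> F) : chi (\sum_i h i) = \prod_i chi (h i).
Proof. by apply: (big_morph chi chiD chi0). Qed.

End RowVectors.

(** * Quadratic Gauss sums *)

Definition gauss (t : F) : C := \sum_x chi (t * x ^+ 2).

Hypothesis two_neq0 : 2 != 0 :> F.
Hypothesis sqrtN1 : exists i : F, i ^+ 2 = -1.

(** Replacing [y] by [i * y] turns x^2 + y^2 into x^2 - y^2. With x = h + y this is h^2 + 2hy, and
    the sum over [y] forces h = 0. *)
Lemma gauss_sqr t : t != 0 -> gauss t ^+ 2 = q.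
Proof.
move=> t0; have [i i2] := sqrtN1.
have i0 : i != 0 by apply: contra_eq_neq i2 => ->; rewrite expr0n /= eq_sym oppr_eq0 oner_eq0.
rewrite expr2 {2}/gauss (reindex_inj (mulfI i0)) /= mulr_suml.
transitivity (\sum_y \sum_h chi (t * h ^+ 2) * chi (y * (t * h * 2))).
  transitivity (\sum_x \sum_y chi (t * x ^+ 2) * chi (t * (i * y) ^+ 2)).
    by apply: eq_bigr => x _; rewrite mulr_sumr.
  rewrite exchange_big; apply: eq_bigr => y _ /=.
  rewrite (reindex_inj (addIr y)) /=; apply: eq_bigr => h _.
  by rewrite -!chiD exprMn i2; congr chi; ring.
rewrite exchange_big /= (eq_bigr (fun h => chi (t * h ^+ 2) * (q * (h == 0)%:R))); last first.
  move=> h _; rewrite -mulr_sumr sum_chi_mul; congr (_ * (_ * (nat_of_bool _)%:R)).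
  by rewrite !mulf_eq0 (negbTE t0) (negbTE two_neq0) orbF.
rewrite (bigD1 0) //= big1 ?addr0 => [|h h0]; last by rewrite (negbTE h0) !mulr0.
by rewrite expr0n !mulr0 chi0 eqxx !mulr1 mul1r.
Qed.

Lemma gauss_neq0 t : t != 0 -> gauss t != 0.
Proof.
move=> t0; rewrite -sqrf_eq0 gauss_sqr // pnatr_eq0 -lt0n.
exact: (ltn_trans _ (finNzRing_gt1 F)).
Qed.

Lemma gauss_mul_sqr t s : s != 0 -> gauss (t * s ^+ 2) = gauss t.
Proof.
move=> s0; rewrite /gauss [RHS](reindex_inj (mulfI s0)) /=.
by apply: eq_bigr => x _; congr chi; ring.
Qed.

(** Expanding [gauss] and summing over [t] first detects x^2 = a. It is used for a = 0 and for a
    nonsquare [a], where no root exists. *)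
Lemma sum_gauss_chi a :
  \sum_(t | t != 0) chi (- (t * a)) * gauss t = q * \sum_x ((x ^+ 2 == a)%:R : C) - q.
Proof.
transitivity (\sum_x \sum_(t | t != 0) chi (t * (x ^+ 2 - a))).
  rewrite exchange_big /=; apply: eq_bigr => t _; rewrite mulr_sumr.
  by apply: eq_bigr => x _; rewrite -chiD; congr chi; ring.
rewrite (eq_bigr (fun x => q * (x ^+ 2 == a)%:R - 1)) => [|x _].
  by rewrite sumrB -mulr_sumr sumr_const.
by rewrite sum_chi_unit subr_eq0.
Qed.

Definition is_sqr (a : F) := [exists x, x ^+ 2 == a].

Lemma sum_gauss_eq0 : \sum_(t | t != 0) gauss t = 0.
Proof.
have := sum_gauss_chi 0.
under eq_bigr do rewrite mulr0 oppr0 chi0 mul1r.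
move->; rewrite (bigD1 0) //= expr0n eqxx big1 ?addr0 ?mulr1 ?subrr // => x x0.
by rewrite sqrf_eq0 (negbTE x0).
Qed.

Hypothesis nonsqr_mul : forall a b : F, ~~ is_sqr a -> ~~ is_sqr b -> is_sqr (a * b).

(** The Gauss sums over all nonzero parameters add up to 0. Pairing each nonzero square s with s a,
    the sum becomes the number of such squares times [gauss t + gauss (t * a)], and that number is
    nonzero. *)
Lemma gauss_nonsqr a t : ~~ is_sqr a -> t != 0 -> gauss (t * a) = - gauss t.
Proof.
move=> aN t0.
have a0 : a != 0 by apply: contra aN => /eqP ->; apply/existsP; exists 0; rewrite expr0n.
have sqrM x y : x != 0 -> is_sqr x -> is_sqr (x * y) = is_sqr y.
  move=> x0 /existsP[r /eqP rx]; apply/existsP/existsP => -[s /eqP sE].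
    by exists (s / r); rewrite expr_div_n sE rx mulrC mulKf.
  by exists (r * s); rewrite exprMn rx sE.
have sqrMN y : y != 0 -> is_sqr (a * y) = ~~ is_sqr y.
  move=> y0; case: (boolP (is_sqr y)) => ysq; last exact: nonsqr_mul.
  by rewrite mulrC sqrM //; apply/negbTE.
have := sum_gauss_eq0.
rewrite (reindex_inj (mulfI t0)) (eq_bigl (fun s => s != 0)) /=; last first.
  by move=> s; rewrite mulf_eq0 (negbTE t0).
rewrite (bigID is_sqr) /= addrC (reindex_inj (mulfI a0)) /= addrC.
rewrite [X in _ + X](eq_bigl (fun s => (s != 0) && is_sqr s)); last first.
  move=> s; rewrite mulf_eq0 (negbTE a0) /=; case: eqP => //= /eqP s0.
  by rewrite sqrMN // negbK.
rewrite -big_split /= (eq_bigr (fun=> gauss t + gauss (t * a))); last first.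
  move=> s /andP[s0 /existsP[r /eqP rs]].
  have r0 : r != 0 by rewrite -sqrf_eq0 rs.
  by rewrite -rs mulrA !gauss_mul_sqr.
rewrite sumr_const -mulr_natr => /eqP; rewrite mulf_eq0 orbC pnatr_eq0.
rewrite (cardD1 1) unfold_in oner_eq0 /=.
have -> : is_sqr 1 by apply/existsP; exists 1; rewrite expr1n.
by rewrite addrC addr_eq0 => /eqP.
Qed.

Section GaussVectors.
Variable d : nat.
Implicit Types w : 'rV[F]_d.

(** Completing the square removes the linear term; what remains factors over the coordinates. *)
Lemma sum_chi_quad (t : F) w : t != 0 ->
  \sum_(x : 'rV[F]_d) chi (t * dotF x x + dotF x w) = gauss t ^+ d * chi (- (dotF w w / (4 * t))).
Proof.
move=> t0; rewrite (reindex_inj (addIr (- ((2 * t)^-1 *: w)))) /=.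
transitivity (\sum_(x : 'rV[F]_d) chi (t * dotF x x) * chi (- (dotF w w / (4 * t)))).
  apply: eq_bigr => x _; rewrite -chiD; congr chi.
  have four0 : 4 != 0 :> F by rewrite (natrM _ 2 2) mulf_neq0.
  by rewrite !dotFE (dotFC w x); field; rewrite t0 four0 two_neq0.
rewrite -mulr_suml; congr (_ * _); rewrite -sum_rV_prod.
apply: eq_bigr => x _; rewrite -chi_sum /dotF mulr_sumr; congr chi.
Qed.

End GaussVectors.

End Character.

(** * Orthogonal pairs of projective points *)

(** Indices in [P] are sent to distinct points of projective space. Proportionality is written as a
    vanishing combination with two nonzero coefficients because the character sums below produce it
    in this shape. *)
Definition projectively_injective (F : finFieldType) (d : nat) (I : finType)
  (P : pred I) (phi : I -> 'rV[F]_d) :=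
  (forall i, P i -> phi i != 0) /\
  (forall i j s t, P i -> P j -> s != 0 -> t != 0 ->
    s *: phi i + t *: phi j = 0 -> i = j).

Section OrthogonalPairs.
Variables (F : finFieldType) (C : numClosedFieldType) (chi : F -> C).
Hypothesis chiD : forall x y, chi (x + y) = chi x * chi y.
Hypothesis chi0 : chi 0 = 1.
Hypothesis chi_neq1 : exists x, chi x != 1.
Local Notation q := (#|F|%:R : C).

Lemma q_gt0 : 0 < q.
Proof. by rewrite ltr0n (ltn_trans _ (finNzRing_gt1 F)). Qed.

Lemma sum_unit_const (x : C) : \sum_(s : F | s != 0) x = (q - 1) * x.
Proof.
apply: (addrI x); rewrite -[LHS](bigD1 0 (P := xpredT) (F := fun=> x)) //=.
by rewrite sumr_const -mulr_natl; ring.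
Qed.

Section Projective.
Variable d : nat.
Implicit Types u v w : 'rV[F]_d.

(** Each factor is a sum of [chi (s * dotF u v)] over nonzero [s]; orthogonality in [u] then keeps
    only the proportionality relations between [v] and [w]. *)
Lemma hyperplane_correlation v w :
  \sum_u (q * (dotF u v == 0)%:R - 1) * (q * (dotF u w == 0)%:R - 1) =
  q ^+ d * \sum_(s | s != 0) \sum_(t | t != 0) ((s *: v + t *: w == 0)%:R : C).
Proof.
transitivity (\sum_u \sum_(s | s != 0) \sum_(t | t != 0) chi (dotF u (s *: v + t *: w))).
  apply: eq_bigr => u _; rewrite -!(sum_chi_unit chiD chi0 chi_neq1) mulr_suml.
  apply: eq_bigr => s _; rewrite mulr_sumr; apply: eq_bigr => t _.
  by rewrite -chiD !dotFE.
rewrite exchange_big mulr_sumr; apply: eq_bigr => s _ /=.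
rewrite exchange_big mulr_sumr; apply: eq_bigr => t _ /=.
by rewrite (sum_chi_dot chiD chi0 chi_neq1).
Qed.

Variables (I : finType) (P : pred I) (h : I -> C) (phi psi : I -> 'rV[F]_d).
Hypothesis h_real : forall i, h i \is Num.real.
Hypothesis h_supp : forall i, h i != 0 -> P i.
Hypothesis phi_inj : projectively_injective P phi.
Hypothesis psi_inj : projectively_injective P psi.

(** The mass of [h] on the hyperplane orthogonal to [u], compared with its expected share 1/q of the
    total and scaled by q. *)
Let e u := \sum_j h j * (q * (dotF u (psi j) == 0)%:R - 1).

Let e_real u : e u \is Num.real.
Proof. by apply: rpred_sum => j _; rewrite rpredM ?rpredB ?rpredM ?rpred1 ?realn. Qed.

Let e_scale (s : F) u : s != 0 -> e (s *: u) = e u.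
Proof.
move=> s0; apply: eq_bigr => j _.
by rewrite dotFZl mulf_eq0 (negbTE s0).
Qed.

(** Off-diagonal correlations vanish since distinct [psi i] are not proportional. On the diagonal
    only t = -s survives, which gives q - 1 relations. *)
Lemma second_moment : \sum_u e u ^+ 2 = q ^+ d * (q - 1) * \sum_i h i ^+ 2.
Proof.
transitivity (\sum_i \sum_j h i * h j * \sum_u (q * (dotF u (psi i) == 0)%:R - 1) *
                                             (q * (dotF u (psi j) == 0)%:R - 1)).
  under eq_bigr => u _.
    rewrite expr2 mulr_suml; under eq_bigr => i _ do rewrite mulr_sumr.
    over.
  rewrite exchange_big; apply: eq_bigr => i _ /=.
  rewrite exchange_big; apply: eq_bigr => j _ /=.
  by rewrite mulr_sumr; apply: eq_bigr => u _; ring.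
rewrite mulr_sumr; apply: eq_bigr => i _.
rewrite (bigD1 i) //= [X in _ + X]big1 ?addr0 => [|j ji].
  have [->|hi] := eqVneq (h i) 0; first by rewrite expr2 !(mul0r, mulr0).
  rewrite hyperplane_correlation expr2 mulrC; congr (_ * _ * _).
  rewrite (eq_bigr (fun=> 1)) => [|s s0].
    by rewrite sum_unit_const mulr1.
  rewrite (bigD1 (- s)) ?oppr_eq0 //= scaleNr subrr eqxx big1 ?addr0 // => t /andP[_ ts].
  by rewrite -scalerDl scaler_eq0 (negbTE (psi_inj.1 i (h_supp hi))) orbF addrC addr_eq0 (negbTE ts).
have [->|hi] := eqVneq (h i) 0; first by rewrite !mul0r.
have [->|hj] := eqVneq (h j) 0; first by rewrite mulr0 mul0r.
rewrite hyperplane_correlation big1 ?mulr0 // => s s0; rewrite big1 // => t t0.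
case: eqP => // /(psi_inj.2 i j s t (h_supp hi) (h_supp hj) s0 t0) ij.
by rewrite ij eqxx in ji.
Qed.

(** [e] is constant on punctured lines through 0, and the multiples [s *: phi i] with [s] nonzero
    are pairwise distinct. Each index of the support is thus seen q - 1 times in the full second
    moment. *)
Lemma second_moment_supp :
  (q - 1) * \sum_(i | h i != 0) e (phi i) ^+ 2 <= \sum_u e u ^+ 2.
Proof.
have -> : (q - 1) * \sum_(i | h i != 0) e (phi i) ^+ 2 =
  \sum_(p : I * F | (h p.1 != 0) && (p.2 != 0)) e (p.2 *: phi p.1) ^+ 2.
  rewrite -(pair_big (fun i => h i != 0) (fun s => s != 0)
    (fun i s => e (s *: phi i) ^+ 2)) /= mulr_sumr.
  apply: eq_bigr => i _; rewrite (eq_bigr (fun=> e (phi i) ^+ 2)).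
    by rewrite sum_unit_const.
  by move=> s s0; rewrite e_scale.
pose A := [pred p : I * F | (h p.1 != 0) && (p.2 != 0)].
rewrite -(big_imset (h := fun p : I * F => p.2 *: phi p.1) (A := A)
  (fun u => e u ^+ 2)) /=.
  rewrite [leRHS](bigID [in [set (fun p : I * F => p.2 *: phi p.1) p | p in A]]) /=.
  by rewrite lerDl; apply: sumr_ge0 => u _; rewrite real_exprn_even_ge0.
move=> [i s] [j t] /andP[/= hi s0] /andP[/= hj t0] st.
have ij : i = j.
  apply: (phi_inj.2 i j s (- t)); rewrite ?oppr_eq0 ?h_supp //.
  by rewrite scaleNr st subrr.
subst j; move/eqP: st; rewrite -subr_eq0 -scalerBl scaler_eq0 (negbTE (phi_inj.1 i (h_supp hi))) orbF.
by rewrite subr_eq0 => /eqP ->.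
Qed.

(** Splitting q 1[u . v = 0] into its mean 1 and the centred remainder gives the main term plus the
    sum of [h i * e (phi i)], which is controlled by the second moment of [e]. *)
Lemma projective_pairs (T : C) : 0 < T -> T ^+ 2 * q ^+ 2 = q ^+ d ->
  \sum_i \sum_j h i * h j * (dotF (phi i) (psi j) == 0)%:R <=
  (\sum_i h i) ^+ 2 / q + T * \sum_i h i ^+ 2.
Proof.
move=> T0 Td; have q0 := q_gt0.
have q1 : 0 < q - 1 by rewrite subr_gt0 ltr1n finNzRing_gt1.
set N := \sum_i \sum_j _.
have NE : q * N = \sum_i h i * e (phi i) + (\sum_i h i) ^+ 2.
  rewrite expr2 mulr_suml mulr_sumr -big_split; apply: eq_bigr => i _ /=.
  rewrite !mulr_sumr -big_split; apply: eq_bigr => j _ /=; ring.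
rewrite -(ler_pM2l q0) NE mulrDr mulrCA divff ?gt_eqF // mulr1 addrC lerD2l.
(* Cauchy-Schwarz in the form 2ab <= a^2 + b^2. The weight q T balances both terms, because (q T)^2
   = q^d is the factor in the second moment. *)
have key : 2 * (q * T) * \sum_i h i * e (phi i) <=
    (q * T) ^+ 2 * \sum_i h i ^+ 2 + \sum_(i | h i != 0) e (phi i) ^+ 2.
  rewrite [X in _ <= _ + X]big_mkcond !mulr_sumr -big_split /=.
  apply: ler_sum => i _; case: eqP => [->|_] /=; first by rewrite expr0n !(mul0r, mulr0) addr0.
  rewrite -subr_ge0; set a := h i; set b := e _.
  have -> : (q * T) ^+ 2 * a ^+ 2 + b ^+ 2 - 2 * (q * T) * (a * b) = (q * T * a - b) ^+ 2.
    by ring.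
  rewrite real_exprn_even_ge0 // rpredB ?e_real // rpredM ?h_real //.
  by rewrite gtr0_real // mulr_gt0.
have supp : \sum_(i | h i != 0) e (phi i) ^+ 2 <= q ^+ d * \sum_i h i ^+ 2.
  rewrite -(ler_pM2l q1); apply: le_trans second_moment_supp _.
  by rewrite second_moment mulrA [_ * q ^+ d]mulrC.
have qT : 0 < 2 * (q * T) by rewrite !mulr_gt0.
rewrite -(ler_pM2l qT); apply: le_trans key _.
apply: le_trans (lerD (lexx _) supp) _.
by rewrite -Td le_eqVlt; apply/orP; left; apply/eqP; ring.
Qed.

End Projective.

End OrthogonalPairs.

(** * Isotropic differences in an elliptic hyperplane *)

Section EllipticPairs.
Variables (F : finFieldType) (C : numClosedFieldType) (chi : F -> C).
Hypothesis chiD : forall x y, chi (x + y) = chi x * chi y.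
Hypothesis chi0 : chi 0 = 1.
Hypothesis chi_neq1 : exists x, chi x != 1.
Local Notation q := (#|F|%:R : C).
Hypothesis two_neq0 : 2 != 0 :> F.
Hypothesis sqrtN1 : exists i : F, i ^+ 2 = -1.
Hypothesis nonsqr_mul : forall a b : F, ~~ is_sqr a -> ~~ is_sqr b -> is_sqr (a * b).
Variable k : nat.
Hypothesis k_gt0 : (0 < k)%N.
Local Notation d := (4 * k - 1)%N.
Implicit Types x y w xi c : 'rV[F]_d.

Lemma gauss_pow (t : F) : t != 0 -> gauss chi t ^+ d = q ^+ (2 * k - 1) * gauss chi t.
Proof.
move=> t0; have -> : d = (2 * (2 * k - 1)).+1 by lia.
by rewrite exprSr exprM (gauss_sqr chiD chi0 chi_neq1 two_neq0 sqrtN1 t0).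
Qed.

(** The frequency t = 0 gives the main term. The others give q^(2k-1) times a sum that counts the
    square roots of [g], of which there are none. *)
Lemma card_sphere (g : F) : ~~ is_sqr g ->
  #|(sphere d g : {set 'rV[F]_d})|%:R = q ^+ d.-1 - q ^+ (2 * k - 1) :> C.
Proof.
move=> gN; have q0 := q_gt0 F C.
apply: (mulfI (lt0r_neq0 q0)).
transitivity (\sum_t \sum_(x : 'rV[F]_d) chi (t * (dotF x x - g))).
  rewrite exchange_big /= -[X in _ * X%:R]sum1_card natr_sum mulr_sumr big_mkcond /=.
  apply: eq_bigr => x _; rewrite (sum_chi_mul chiD chi0 chi_neq1) subr_eq0 in_sphere.
  by case: eqP; rewrite ?mulr0.
rewrite (bigD1 0) //= [X in X + _](eq_bigr (fun=> 1)) => [|x _]; last by rewrite mul0r.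
rewrite sumr_const card_mx mul1n natrX mulrBr -exprS prednK ?subn_gt0; last by lia.
congr (_ + _).
transitivity (\sum_(t | t != 0) q ^+ (2 * k - 1) * (chi (- (t * g)) * gauss chi t)).
  apply: eq_bigr => t t0; rewrite mulrCA -gauss_pow // -(mulr1 (_ ^+ d)).
  have := sum_chi_quad chiD chi0 two_neq0 (0 : 'rV[F]_d) t0.
  rewrite dotF0l mul0r oppr0 chi0 => <-; rewrite mulr_sumr.
  by apply: eq_bigr => x _; rewrite -chiD dotFC dotF0l; congr chi; ring.
rewrite -mulr_sumr (sum_gauss_chi chiD chi0 chi_neq1) big1 => [|x _].
  by rewrite mulr0 sub0r mulrN mulrC.
by case: eqP => // xg; case/negP: gN; apply/existsP; exists x; apply/eqP.
Qed.

Section Elliptic.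
Variable c : 'rV[F]_d.
Hypothesis c_nonsqr : ~~ is_sqr (dotF c c).

Let c_neq0 : dotF c c != 0.
Proof. by apply: contra c_nonsqr => /eqP->; apply/existsP; exists 0; rewrite expr0n. Qed.

(* The quadratic form induced on the quotient by the line [F c], identified
   with the hyperplane orthogonal to [c]. *)
Definition proj_form xi := dotF xi xi - dotF xi c ^+ 2 / dotF c c.

(** Multiplying by [gauss (t * dotF c c)] restores the missing direction [c] and yields q copies of
    the full Gaussian sum. This factor is [- gauss t] because [dotF c c] is a nonsquare: the minus
    sign expresses ellipticity. *)
Lemma sum_chi_proj_form (t : F) w : t != 0 -> dotF w c = 0 ->
  \sum_xi chi (t * proj_form xi + dotF xi w) =
  - (q ^+ (2 * k) * chi (- (dotF w w / (4 * t)))).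
Proof.
move=> t0 wc.
have G0 := gauss_neq0 chiD chi0 chi_neq1 two_neq0 sqrtN1 t0.
apply: (mulfI G0); rewrite -[LHS]opprK -mulNr.
rewrite -(gauss_nonsqr chiD chi0 chi_neq1 nonsqr_mul c_nonsqr t0).
rewrite mulrN; congr (- _).
transitivity (\sum_(l : F) (gauss chi t ^+ d * chi (- (dotF w w / (4 * t))))); last first.
  rewrite sumr_const -mulr_natl gauss_pow //.
  have -> : q ^+ (2 * k) = q * q ^+ (2 * k - 1) by rewrite -exprS; congr (_ ^+ _); lia.
  ring.
rewrite mulr_sumr.
transitivity (\sum_xi \sum_l chi (t * dotF (xi + l *: c) (xi + l *: c) + dotF (xi + l *: c) w)).
  apply: eq_bigr => xi _; rewrite /gauss (reindex_inj (addIr (dotF xi c / dotF c c))) /=.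
  rewrite mulr_suml; apply: eq_bigr => l _; rewrite -chiD; congr chi.
  rewrite !dotFE (dotFC c w) wc (dotFC c xi) /proj_form; field.
  exact: c_neq0.
rewrite exchange_big; apply: eq_bigr => l _ /=.
rewrite -(sum_chi_quad chiD chi0 two_neq0) // [RHS](reindex_inj (addIr (l *: c))) /=.
by [].
Qed.

Lemma sum_chi_inv (a : F) :
  \sum_(t | t != 0) chi (- (a / (4 * t))) = q * (a == 0)%:R - 1.
Proof.
have four0 : 4 != 0 :> F by rewrite (natrM _ 2 2) mulf_neq0.
rewrite -(sum_chi_unit chiD chi0 chi_neq1).
have inv_inj : injective (fun t : F => - (4 * t)^-1).
  by move=> s t /oppr_inj /invr_inj /(mulfI four0).
rewrite (reindex_inj inv_inj) /=.
apply: eq_big => [t|t t0].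
  by rewrite oppr_eq0 invr_eq0 mulf_eq0 (negbTE four0).
congr chi; field; rewrite four0 oppr_eq0 oner_eq0 andbT.
by move: t0; rewrite ?oppr_eq0 ?invr_eq0 ?mulf_eq0 ?(negbTE four0).
Qed.

(** The sum of |h^|^2 over the cone [proj_form xi = 0] is nonnegative. Expanded over pairs, it has
    weight q^d on the diagonal, q^(2k) everywhere and, by ellipticity, -q^(2k+1) on isotropic
    differences. Moving the last term across bounds the number of isotropic pairs. *)
Lemma elliptic_pairs (kappa : F) (h : 'rV[F]_d -> C) :
  (forall x, h x \is Num.real) -> (forall x, h x != 0 -> dotF x c = kappa) ->
  \sum_x \sum_y h x * h y * (dotF (x - y) (x - y) == 0)%:R <=
  (\sum_x h x) ^+ 2 / q + q ^+ (2 * k - 2) * \sum_x h x ^+ 2.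
Proof.
move=> h_real h_supp; have q0 := q_gt0 F C.
set N := \sum_x \sum_y _.
pose hat xi := \sum_x h x * chi (dotF xi x).
have P_ge0 : 0 <= \sum_xi hat xi * (hat xi)^* * (q * (proj_form xi == 0)%:R).
  by apply: sumr_ge0 => xi _; rewrite mulr_ge0 ?mul_conjC_ge0 // mulr_ge0 ?ler0n.
have PE : \sum_xi hat xi * (hat xi)^* * (q * (proj_form xi == 0)%:R) =
    \sum_x \sum_y h x * h y * (\sum_xi \sum_t chi (t * proj_form xi + dotF xi (x - y))).
  transitivity (\sum_xi \sum_x \sum_y h x * h y * \sum_t chi (t * proj_form xi + dotF xi (x - y))).
    apply: eq_bigr => xi _; rewrite -(sum_chi_mul chiD chi0 chi_neq1).
    rewrite /hat rmorph_sum mulr_suml mulr_suml; apply: eq_bigr => x _.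
    rewrite [X in X * _]mulr_sumr mulr_suml; apply: eq_bigr => y _.
    rewrite rmorphM /= (CrealP (h_real y)) (chi_conj chiD chi0).
    rewrite !mulr_sumr; apply: eq_bigr => t _.
    rewrite chiD dotFDr chiD dotFNr; ring.
  rewrite exchange_big; apply: eq_bigr => x _ /=.
  rewrite exchange_big; apply: eq_bigr => y _ /=.
  by rewrite mulr_sumr.
have inner x y : h x * h y * (\sum_xi \sum_t chi (t * proj_form xi + dotF xi (x - y))) =
    h x * h y * (q ^+ d * (x == y)%:R - q ^+ (2 * k) * (q * (dotF (x - y) (x - y) == 0)%:R - 1)).
  have [->|hx] := eqVneq (h x) 0; first by rewrite !mul0r.
  have [->|hy] := eqVneq (h y) 0; first by rewrite mulr0 !mul0r.
  have xyc : dotF (x - y) c = 0 by rewrite !dotFE (h_supp x hx) (h_supp y hy) subrr.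
  congr (_ * _); rewrite exchange_big (bigD1 0) //=; congr (_ + _).
    rewrite -subr_eq0 -(sum_chi_dot chiD chi0 chi_neq1).
    by apply: eq_bigr => xi _; rewrite mul0r add0r.
  rewrite -sum_chi_inv mulr_sumr -sumrN; apply: eq_bigr => t t0.
  exact: sum_chi_proj_form.
have diag : \sum_x \sum_y h x * h y * (x == y)%:R = \sum_x h x ^+ 2.
  apply: eq_bigr => x _; rewrite (bigD1 x) //= eqxx mulr1 big1 ?addr0 // => y yx.
  by rewrite eq_sym (negbTE yx) mulr0.
have full : \sum_x \sum_y h x * h y = (\sum_x h x) ^+ 2.
  by rewrite expr2 mulr_suml; apply: eq_bigr => x _; rewrite mulr_sumr.
have total : \sum_x \sum_y h x * h y * (\sum_xi \sum_t chi (t * proj_form xi + dotF xi (x - y))) =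
    q ^+ d * (\sum_x h x ^+ 2) + q ^+ (2 * k) * (\sum_x h x) ^+ 2 - q ^+ (2 * k) * q * N.
  rewrite -diag -full /N !mulr_sumr -sumrN -!big_split; apply: eq_bigr => x _ /=.
  rewrite !mulr_sumr -sumrN -!big_split; apply: eq_bigr => y _ /=.
  by rewrite inner; ring.
have qk : 0 < q ^+ (2 * k) * q by rewrite mulr_gt0 ?exprn_gt0.
rewrite -subr_ge0 -(pmulr_rge0 _ qk).
move: P_ge0; rewrite PE total; congr (0 <= _).
have -> : q ^+ d = q ^+ (2 * k) * q * q ^+ (2 * k - 2).
  by rewrite -exprSr -exprD; congr (_ ^+ _); lia.
field; exact: lt0r_neq0.
Qed.

End Elliptic.
End EllipticPairs.

(** * Sums over parallelograms *)

Section RectangleSums.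
Variables (V : finZmodType) (R : realFieldType).
Implicit Types (x y z : V) (f : V -> R).

Definition energy f := \sum_z \sum_x \sum_y f x * f y * (f z * f (x + y - z)).

Lemma energy_ge0 f : (forall x, 0 <= f x) -> 0 <= energy f.
Proof. by move=> f0; do 3!(apply: sumr_ge0 => ? _); rewrite !mulr_ge0. Qed.

(** The four terms of the majorant have equal sums: the symmetries of [P] swap [x] and [y], replace
    the corner [z] by the opposite one, and exchange the two diagonals. *)
Lemma rectangle_sum (P : V -> V -> V -> bool) (f phi psi : V -> R) :
  (forall x y z, P x y z = P y x z) ->
  (forall x y z, P x y z = P x y (x + y - z)) ->
  (forall x y z, P x y z = P z (x + y - z) x) ->
  (forall x y z w, f x * f y * (f z * f w) <=
    phi x * phi y * psi z + phi x * phi y * psi w +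
    (phi z * phi w * psi x + phi z * phi w * psi y)) ->
  \sum_z \sum_x \sum_y (P x y z)%:R * (f x * f y * (f z * f (x + y - z))) <=
  4 * \sum_z psi z * \sum_x \sum_y phi x * phi y * (P x y z)%:R.
Proof.
move=> Psym Pflip Prot fP.
set B := \sum_z psi z * _.
have B1 : \sum_z \sum_x \sum_y (P x y z)%:R * (phi x * phi y * psi z) = B.
  apply: eq_bigr => z _; rewrite mulr_sumr; apply: eq_bigr => x _.
  by rewrite mulr_sumr; apply: eq_bigr => y _; ring.
have B2 : \sum_z \sum_x \sum_y (P x y z)%:R * (phi x * phi y * psi (x + y - z)) = B.
  rewrite -B1 exchange_big [RHS]exchange_big; apply: eq_bigr => x _ /=.
  rewrite exchange_big [RHS]exchange_big; apply: eq_bigr => y _ /=.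
  have inj : injective (fun z => x + y - z) by move=> z w /addrI /oppr_inj.
  by rewrite [RHS](reindex_inj inj); apply: eq_bigr => z _ /=; rewrite -Pflip.
have B3 : \sum_z \sum_x \sum_y (P x y z)%:R * (phi z * phi (x + y - z) * psi x) = B.
  rewrite -B1 [RHS]exchange_big; apply: eq_bigr => z _; apply: eq_bigr => x _.
  have inj : injective (fun y => x + y - z) by move=> y w /addIr /addrI.
  by rewrite [RHS](reindex_inj inj); apply: eq_bigr => y _ /=; rewrite -Prot.
have B4 : \sum_z \sum_x \sum_y (P x y z)%:R * (phi z * phi (x + y - z) * psi y) = B.
  rewrite -B3; apply: eq_bigr => z _; rewrite exchange_big.
  apply: eq_bigr => x _; apply: eq_bigr => y _.
  by rewrite Psym (addrC y).
have -> : 4 * B = B + B + (B + B) by ring.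
rewrite -{1}B1 -{1}B2 -{1}B3 -{1}B4 -!big_split; apply: ler_sum => z _ /=.
rewrite -!big_split; apply: ler_sum => x _ /=.
rewrite -!big_split; apply: ler_sum => y _ /=.
by case: (P x y z); rewrite ?mul1r ?mul0r ?addr0.
Qed.

End RectangleSums.

(** * Energy of functions on the sphere, by isotropy of the sides *)

Section SphereEnergy.
Variables (R : realType) (F : finFieldType) (chi : F -> R[i]).
Hypothesis chiD : forall x y, chi (x + y) = chi x * chi y.
Hypothesis chi0 : chi 0 = 1.
Hypothesis chi_neq1 : exists x, chi x != 1.
Local Notation q := (#|F|%:R : R).
Hypothesis two_neq0 : 2 != 0 :> F.
Hypothesis sqrtN1 : exists i : F, i ^+ 2 = -1.
Hypothesis nonsqr_mul : forall a b : F, ~~ is_sqr a -> ~~ is_sqr b -> is_sqr (a * b).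
Hypothesis q_ge5 : (5 <= #|F|)%N.
Variable k : nat.
Hypothesis k_gt0 : (0 < k)%N.
Local Notation d := (4 * k - 1)%N.
Variable T : R.
Hypothesis T_gt0 : 0 < T.
Hypothesis T_sqr : T ^+ 2 * q ^+ 2 = q ^+ d.
Variable g : F.
Hypothesis g_nonsqr : ~~ is_sqr g.
Implicit Types (x y z v : 'rV[F]_d) (f h phi psi : 'rV[F]_d -> R).

Local Notation sq x := (dotF x x).

Lemma real_projective_pairs (P : pred 'rV[F]_d) h (phi psi : 'rV[F]_d -> 'rV[F]_d) :
  (forall x, h x != 0 -> P x) ->
  projectively_injective P phi -> projectively_injective P psi ->
  \sum_x \sum_y h x * h y * (dotF (phi x) (psi y) == 0)%:R <=
  (\sum_x h x) ^+ 2 / q + T * \sum_x h x ^+ 2.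
Proof.
move=> h_supp phi_inj psi_inj.
pose hC x := (h x)%:C%C.
have hC_real x : hC x \is Num.real by rewrite complex_real.
have hC_supp x : hC x != 0 -> P x by rewrite fmorph_eq0; apply: h_supp.
have T_sqrC : T%:C%C ^+ 2 * #|F|%:R ^+ 2 = #|F|%:R ^+ d :> R[i].
  by have := congr1 (real_complex R) T_sqr; rewrite rmorphM !rmorphXn rmorph_nat.
have := projective_pairs chiD chi0 chi_neq1 hC_real hC_supp phi_inj psi_inj _ T_sqrC.
rewrite -lecR ltcR => /(_ T_gt0); congr (_ <= _).
  rewrite rmorph_sum; apply: eq_bigr => x _; rewrite rmorph_sum; apply: eq_bigr => y _.
  by rewrite !rmorphM rmorph_nat.
rewrite rmorphD rmorphM rmorphXn fmorphV rmorph_nat rmorphM !rmorph_sum; congr (_ + _ * _).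
by apply: eq_bigr => x _; rewrite rmorphXn.
Qed.

(** The elliptic constant q^(2k-2) is at most T = q^(2k-3/2), so both kinds of pairs obey the same
    bound. *)
Lemma real_elliptic_pairs (c : 'rV[F]_d) (kappa : F) h :
  ~~ is_sqr (sq c) -> (forall x, h x != 0 -> dotF x c = kappa) ->
  \sum_x \sum_y h x * h y * (sq (x - y) == 0)%:R <=
  (\sum_x h x) ^+ 2 / q + T * \sum_x h x ^+ 2.
Proof.
move=> c_nonsqr h_supp.
have q0 : 0 < q by rewrite ltr0n (leq_trans _ q_ge5).
pose hC x := (h x)%:C%C.
have hC_real x : hC x \is Num.real by rewrite complex_real.
have hC_supp x : hC x != 0 -> dotF x c = kappa by rewrite fmorph_eq0; apply: h_supp.
have := elliptic_pairs chiD chi0 chi_neq1 two_neq0 sqrtN1 nonsqr_mul k_gt0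
  c_nonsqr hC_real hC_supp.
have -> : \sum_x \sum_y hC x * hC y * (sq (x - y) == 0)%:R =
    (\sum_x \sum_y h x * h y * (sq (x - y) == 0)%:R)%:C%C.
  rewrite rmorph_sum; apply: eq_bigr => x _; rewrite rmorph_sum; apply: eq_bigr => y _.
  by rewrite !rmorphM rmorph_nat.
have -> : (\sum_x hC x) ^+ 2 / #|F|%:R + #|F|%:R ^+ (2 * k - 2) * \sum_x hC x ^+ 2 =
    ((\sum_x h x) ^+ 2 / q + q ^+ (2 * k - 2) * \sum_x h x ^+ 2)%:C%C.
  rewrite rmorphD rmorphM rmorphXn fmorphV rmorph_nat rmorphM rmorphXn rmorph_nat !rmorph_sum; congr (_ + _ * _).
  by apply: eq_bigr => x _; rewrite rmorphXn.
rewrite lecR => /le_trans; apply; rewrite lerD2l ler_wpM2r //.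
  by apply: sumr_ge0 => x _; apply: sqr_ge0.
rewrite -(ler_pXn2r (n := 2)) ?nnegrE ?(ltW T_gt0) ?exprn_ge0 ?(ltW q0) //.
rewrite -(ler_pM2r (exprn_gt0 2 q0)) T_sqr -exprM -exprD ler_weXn2l ?ler1n //; lia.
Qed.

(** Rectangles are grouped by the non-isotropic side v = y - z, with weight
    [H v x = f x * f (x + v)] on the parallel sides. Having [x] and [x + v] on the sphere fixes
    [dotF x v]. The main terms add up to the energy itself over q, which is small enough to be
    absorbed later. *)
Lemma mixed_energy f : (forall x, 0 <= f x) -> (forall x, f x != 0 -> sq x = g) ->
  \sum_z \sum_x \sum_y ((sq (x - z) == 0) && (sq (y - z) != 0))%:R *
    (f x * f y * (f z * f (x + y - z))) <=
  energy f / q + T * (\sum_x f x ^+ 2) ^+ 2.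
Proof.
move=> f0 f_supp; have q0 : 0 < q by rewrite ltr0n (leq_trans _ q_ge5).
pose H v x := f x * f (x + v).
have HE : energy f = \sum_v (\sum_x H v x) ^+ 2.
  transitivity (\sum_z \sum_x \sum_v H v x * H v z).
    apply: eq_bigr => z _; apply: eq_bigr => x _.
    rewrite (reindex_inj (addIr z)); apply: eq_bigr => v _ /=.
    by rewrite /H addrA addrK (addrC v); ring.
  rewrite exchange_big /=; under eq_bigr do rewrite exchange_big /=.
  rewrite exchange_big; apply: eq_bigr => v _ /=.
  by rewrite expr2 mulr_suml; apply: eq_bigr => x _; rewrite mulr_sumr.
have H2 : (\sum_x f x ^+ 2) ^+ 2 = \sum_v \sum_x H v x ^+ 2.
  rewrite expr2 mulr_suml exchange_big; apply: eq_bigr => x _ /=.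
  rewrite mulr_sumr (reindex_inj (addrI x)); apply: eq_bigr => v _ /=.
  by rewrite exprMn.
rewrite HE H2 mulr_suml mulr_sumr -big_split /=.
have -> : \sum_z \sum_x \sum_y ((sq (x - z) == 0) && (sq (y - z) != 0))%:R *
    (f x * f y * (f z * f (x + y - z))) =
    \sum_v (sq v != 0)%:R * \sum_x \sum_z H v x * H v z * (sq (x - z) == 0)%:R.
  transitivity (\sum_z \sum_x \sum_v (sq v != 0)%:R * (H v x * H v z * (sq (x - z) == 0)%:R)).
    apply: eq_bigr => z _; apply: eq_bigr => x _.
    rewrite (reindex_inj (addIr z)); apply: eq_bigr => v _ /=.
    by rewrite /H addrA !addrK (addrC v) -mulnb natrM; ring.
  rewrite exchange_big /=; under eq_bigr do rewrite exchange_big /=.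
  rewrite exchange_big; apply: eq_bigr => v _ /=.
  by rewrite mulr_sumr; apply: eq_bigr => x _; rewrite mulr_sumr.
apply: ler_sum => v _.
have rhs0 : 0 <= (\sum_x H v x) ^+ 2 / q + T * \sum_x H v x ^+ 2.
  apply: addr_ge0; apply: mulr_ge0; rewrite ?sqr_ge0 ?invr_ge0 ?(ltW q0) ?(ltW T_gt0) //.
  by apply: sumr_ge0 => x _; apply: sqr_ge0.
case: eqP => [_|/eqP v0]; rewrite ?mul0r // mul1r.
have H_supp x : H v x != 0 -> sq x = g /\ dotF x v = - (sq v / 2).
  rewrite mulf_eq0 => /norP[/f_supp xg /f_supp]; rewrite !dotFE xg (dotFC v x) => /eqP.
  rewrite -subr_eq0 => /eqP xv; split => //.
  apply: (mulfI two_neq0); have -> : 2 * - (sq v / 2) = - sq v by field.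
  by apply/eqP; rewrite -subr_eq0 -xv; apply/eqP; ring.
(* If [sq v = 4 * g], the number [a] chosen below would be 0; but then [sq v] is a nonsquare and the
   section is elliptic. *)
have [v4|v4] := eqVneq (sq v) (4 * g).
  apply: (@real_elliptic_pairs v (- (sq v / 2))) => [|x /H_supp[]//].
  rewrite v4; apply: contra g_nonsqr => /existsP[r /eqP r2]; apply/existsP; exists (r / 2).
  by rewrite expr_div_n r2 -(natrX _ 2 2) mulrC mulKf // natrX expf_neq0.
(* [a] is chosen so that [(x + 3v/2) . (z + (1/2 + a)v) = x . z - g]. *)
pose a := - (g - sq v / 4) / sq v.
have four0 : 4 != 0 :> F by rewrite (natrM _ 2 2) mulf_neq0.
have a0 : a != 0.
  rewrite mulf_neq0 ?invr_eq0 // oppr_eq0 subr_eq0; apply: contra v4 => /eqP ->.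
  by apply/eqP; field.
(* The shift puts the section into the hyperplane where the product with [v] is [b * sq v]. For [b]
   nonzero it misses 0, so it meets each line through 0 at most once. *)
pose shift (b : F) x := x + (2^-1 + b) *: v.
have shift_v b x : dotF x v = - (sq v / 2) -> dotF (shift b x) v = b * sq v.
  by move=> xv; rewrite !dotFE xv; field.
pose P := [pred x | dotF x v == - (sq v / 2)].
have shift_inj b : b != 0 -> projectively_injective P (shift b).
  move=> b0; have bv : b * sq v != 0 by rewrite mulf_neq0.
  split=> [x /eqP xv|x y s t /eqP xv /eqP yv s0 t0 st].
    by apply: contra bv => /eqP x0; rewrite -(shift_v b x) // x0 dotF0l.
  have := congr1 (fun w => dotF w v) st.
  rewrite /= dotFDl !dotFZl !shift_v // dotF0l -mulrDl => /eqP.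
  rewrite mulf_eq0 (negbTE bv) orbF addr_eq0 => /eqP ts; move: st; rewrite ts scaleNr addrC.
  by move/eqP; rewrite subr_eq0 => /eqP /(scalerI t0) /addIr.
have := @real_projective_pairs P (H v) (shift 1) (shift a) _
  (shift_inj 1 (oner_neq0 _)) (shift_inj a a0).
move=> /(_ (fun x Hx => introT eqP (H_supp x Hx).2)); congr (_ <= _).
apply: eq_bigr => x _; apply: eq_bigr => z _.
have [->|Hx] := eqVneq (H v x) 0; first by rewrite !mul0r.
have [->|Hz] := eqVneq (H v z) 0; first by rewrite mulr0 !mul0r.
have [[xg xv] [zg zv]] := (H_supp x Hx, H_supp z Hz).
congr (_ * (nat_of_bool _)%:R).
have -> : dotF (shift 1 x) (shift a z) = dotF x z - g.
  by rewrite !dotFE (dotFC v z) xv zv /a; field; rewrite v0 two_neq0 four0.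
have -> : sq (x - z) = - 2 * (dotF x z - g) by rewrite !dotFE xg zg (dotFC z x); ring.
by rewrite mulf_eq0 oppr_eq0 (negbTE two_neq0).
Qed.

(** A condition on [x] and [y] separately can be moved into the weight, and the right side is
    monotone in the nonnegative weight. *)
Lemma restrict_pairs (B : rel 'rV[F]_d) (P : pred 'rV[F]_d) h : (forall x, 0 <= h x) ->
  let h' x := h x * (P x)%:R in
  \sum_x \sum_y h' x * h' y * (B x y)%:R <=
    (\sum_x h' x) ^+ 2 / q + T * \sum_x h' x ^+ 2 ->
  \sum_x \sum_y h x * h y * [&& P x, P y & B x y]%:R <=
    (\sum_x h x) ^+ 2 / q + T * \sum_x h x ^+ 2.
Proof.
move=> h0 h' hB; have q0 : 0 < q by rewrite ltr0n (leq_trans _ q_ge5).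
have h'0 x : 0 <= h' x by rewrite mulr_ge0 ?ler0n.
have h'h x : h' x <= h x by rewrite /h'; case: (P x); rewrite ?mulr1 ?mulr0.
apply: (@le_trans _ _ (\sum_x \sum_y h' x * h' y * (B x y)%:R)).
  rewrite le_eqVlt; apply/orP; left; apply/eqP; apply: eq_bigr => x _; apply: eq_bigr => y _.
  by rewrite /h' -!mulnb !natrM; ring.
apply: le_trans hB _; apply: lerD.
  rewrite ler_wpM2r ?invr_ge0 ?(ltW q0) // lerXn2r ?nnegrE ?sumr_ge0 //.
  exact: ler_sum.
by rewrite ler_wpM2l ?(ltW T_gt0) // ler_sum // => x _; rewrite lerXn2r ?nnegrE.
Qed.

(** On the sphere, [sq (x - z) = - 2 * dotF (x - z) z] is linear in x - z as well as quadratic. If x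
    - z and y - z are proportional and not isotropic, comparing the two scalings forces the ratio to
    be 1. *)
Lemma nonisotropic_corners h z : sq z = g -> (forall x, 0 <= h x) ->
  (forall x, h x != 0 -> sq x = g) ->
  \sum_x \sum_y h x * h y *
    [&& sq (x - z) != 0, sq (y - z) != 0 & dotF (x - z) (y - z) == 0]%:R <=
  (\sum_x h x) ^+ 2 / q + T * \sum_x h x ^+ 2.
Proof.
move=> zg h0 h_supp.
apply: (@restrict_pairs (fun x y => dotF (x - z) (y - z) == 0) (fun x => sq (x - z) != 0)) => //.
pose P := [pred x | (sq x == g) && (sq (x - z) != 0)].
have shift_inj : projectively_injective P (fun x => x - z).
  split=> [x /andP[_]|x y s t /andP[/eqP xg xz] /andP[/eqP yg yz] s0 t0 st].
    by apply: contra => /eqP ->; rewrite dotF0l.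
  have sqE u : sq u = g -> sq (u - z) = - 2 * dotF (u - z) z.
    by move=> ug; rewrite !dotFE ug zg (dotFC z u); ring.
  have su : s *: (x - z) = - (t *: (y - z)) by apply/eqP; rewrite -addr_eq0 st.
  have lin : s * sq (x - z) = - t * sq (y - z).
    rewrite !sqE // mulrCA -dotFZl su dotFNl dotFZl; ring.
  have quad : s ^+ 2 * sq (x - z) = t ^+ 2 * sq (y - z).
    transitivity (sq (s *: (x - z))); first by rewrite dotFZl dotFZr; ring.
    by rewrite su dotFNl dotFNr opprK dotFZl dotFZr; ring.
  have : t * (s + t) * sq (y - z) == 0.
    have tE : t * sq (y - z) = - (s * sq (x - z)) by rewrite lin; ring.
    have -> : t * (s + t) * sq (y - z) = s * (t * sq (y - z)) + t ^+ 2 * sq (y - z) by ring.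
    by rewrite tE -quad; apply/eqP; ring.
  rewrite !mulf_eq0 (negbTE t0) (negbTE yz) orbF /= addr_eq0 => /eqP sNt.
  move: su; rewrite sNt scaleNr => /oppr_inj /(scalerI t0).
  exact: addIr.
apply: (real_projective_pairs _ shift_inj shift_inj) => x.
by rewrite mulf_eq0 pnatr_eq0 eqb0 => /norP[/h_supp xg /negPn xz]; rewrite /= xg eqxx.
Qed.

(** Orthogonal isotropic sides have an isotropic difference x - y, and isotropy of x - z means
    [dotF x z = g]. Hence the elliptic estimate applies with c = z, as [sq z = g] is a nonsquare. *)
Lemma isotropic_corners h z : sq z = g -> (forall x, 0 <= h x) ->
  (forall x, h x != 0 -> sq x = g) ->
  \sum_x \sum_y h x * h y *
    [&& sq (x - z) == 0, sq (y - z) == 0 & dotF (x - z) (y - z) == 0]%:R <=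
  (\sum_x h x) ^+ 2 / q + T * \sum_x h x ^+ 2.
Proof.
move=> zg h0 h_supp.
apply: (@le_trans _ _ (\sum_x \sum_y h x * h y *
    [&& sq (x - z) == 0, sq (y - z) == 0 & sq (x - y) == 0]%:R)).
  apply: ler_sum => x _; apply: ler_sum => y _; rewrite ler_wpM2l ?mulr_ge0 // ler_nat.
  case: eqP => // xz; case: eqP => //= yz; case: eqP => //= xy; case: eqP => //= -[].
  have -> : x - y = (x - z) - (y - z) by rewrite opprB addrA subrK.
  move: (x - z) (y - z) xz yz xy => u w xz yz xy.
  by rewrite !dotFE xz yz (dotFC w u) xy; ring.
apply: (@restrict_pairs (fun x y => sq (x - y) == 0) (fun x => sq (x - z) == 0)) => //.
apply: (@real_elliptic_pairs z g); first by rewrite zg.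
move=> x; rewrite mulf_eq0 pnatr_eq0 eqb0 => /norP[/h_supp xg].
rewrite negbK => /eqP; rewrite !dotFE xg zg (dotFC z x) => xz.
apply: (mulfI two_neq0); apply/eqP; rewrite -subr_eq0 -oppr_eq0 -xz; apply/eqP; ring.
Qed.

(** Rectangles with two sides of the same kind have all the symmetries of [rectangle_sum], so [f] is
    replaced there by [phi] and [psi]. The mixed kind is not symmetric in [x] and [y] and is bounded
    through [f] itself, once for each order. *)
Lemma energy_bound f phi psi :
  (forall x, 0 <= f x) -> (forall x, 0 <= phi x) -> (forall x, 0 <= psi x) ->
  (forall x, f x != 0 -> sq x = g) -> (forall x, phi x != 0 -> sq x = g) ->
  (forall x, psi x != 0 -> sq x = g) ->
  (forall x y z w, f x * f y * (f z * f w) <=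
    phi x * phi y * psi z + phi x * phi y * psi w +
    (phi z * phi w * psi x + phi z * phi w * psi y)) ->
  energy f <= 14 * ((\sum_x psi x) * ((\sum_x phi x) ^+ 2 / q + T * \sum_x phi x ^+ 2)) +
              4 * (T * (\sum_x f x ^+ 2) ^+ 2).
Proof.
move=> f0 phi0 psi0 f_supp phi_supp psi_supp fP.
have q0 : 0 < q by rewrite ltr0n (leq_trans _ q_ge5).
set M := _ / q + _.
pose P1 x y z := [&& sq (x - z) != 0, sq (y - z) != 0 & dotF (x - z) (y - z) == 0].
pose P2 x y z := [&& sq (x - z) == 0, sq (y - z) == 0 & dotF (x - z) (y - z) == 0].
pose P3 x y z := (sq (x - z) == 0) && (sq (y - z) != 0).
pose E (P : 'rV[F]_d -> 'rV[F]_d -> 'rV[F]_d -> bool) :=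
  \sum_z \sum_x \sum_y (P x y z)%:R * (f x * f y * (f z * f (x + y - z))).
have split4 : energy f <= E P1 + E P2 + (E P3 + E (fun x y => P3 y x)).
  rewrite -!big_split; apply: ler_sum => z _ /=.
  rewrite -!big_split; apply: ler_sum => x _ /=.
  rewrite -!big_split; apply: ler_sum => y _ /=.
  rewrite -!mulrDl -!natrD.
  set t := f x * _ * _; have [->|t0] := eqVneq t 0; first by rewrite mulr0.
  rewrite ler_peMl ?mulr_ge0 // ler1n.
  move: t0; rewrite !mulf_eq0 !negb_or => /andP[/andP[/f_supp xg /f_supp yg]].
  move=> /andP[/f_supp zg /f_supp wg].
  have xyz : dotF (x - z) (y - z) == 0.
    apply/eqP/(mulfI two_neq0); transitivity (sq (x + y - z) - g); last by rewrite wg subrr mulr0.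
    by rewrite !dotFE xg yg zg (dotFC y x) (dotFC z x) (dotFC z y); ring.
  by rewrite /P1 /P2 /P3 xyz !andbT; case: eqP; case: eqP.
have corner (u w : 'rV[F]_d) : dotF (- u) (- w) = dotF u w by rewrite dotFNl dotFNr opprK.
have flip1 x y z : x - (x + y - z) = - (y - z) by rewrite !opprB opprD addrCA addNKr.
have flip2 x y z : y - (x + y - z) = - (x - z) by rewrite (addrC x) flip1.
have rot x y z : x + y - z - x = y - z by rewrite addrAC (addrC x) addrK.
have bound (P : 'rV[F]_d -> 'rV[F]_d -> 'rV[F]_d -> bool) : (forall x y z, P x y z = P y x z) ->
    (forall x y z, P x y z = P x y (x + y - z)) ->
    (forall x y z, P x y z = P z (x + y - z) x) ->
    (forall z, sq z = g -> \sum_x \sum_y phi x * phi y * (P x y z)%:R <= M) ->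
    E P <= 4 * ((\sum_x psi x) * M).
  move=> Psym Pflip Prot PM.
  apply: le_trans (rectangle_sum Psym Pflip Prot fP) _.
  rewrite ler_pM2l // mulr_suml; apply: ler_sum => z _.
  have [->|/psi_supp zg] := eqVneq (psi z) 0; first by rewrite !mul0r.
  by rewrite ler_wpM2l ?PM.
have E1 : E P1 <= 4 * ((\sum_x psi x) * M).
  apply: bound => [x y z|x y z|x y z|z zg]; last exact: nonisotropic_corners.
  - by rewrite /P1 (dotFC (y - z)) andbCA.
  - by rewrite /P1 flip1 flip2 !corner (dotFC (y - z)) andbCA.
  - by rewrite /P1 rot -(opprB x z) corner dotFNl oppr_eq0.
have E2 : E P2 <= 4 * ((\sum_x psi x) * M).
  apply: bound => [x y z|x y z|x y z|z zg]; last exact: isotropic_corners.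
  - by rewrite /P2 (dotFC (y - z)) andbCA.
  - by rewrite /P2 flip1 flip2 !corner (dotFC (y - z)) andbCA.
  - by rewrite /P2 rot -(opprB x z) corner dotFNl oppr_eq0.
have E3 : E P3 <= energy f / q + T * (\sum_x f x ^+ 2) ^+ 2 by exact: mixed_energy.
have E4 : E (fun x y => P3 y x) = E P3.
  apply: eq_bigr => z _; rewrite exchange_big; apply: eq_bigr => x _.
  by apply: eq_bigr => y _; rewrite (addrC y) (mulrC (f y)).
(* The two mixed terms cost at most 2/5 of the energy. Absorbing them multiplies the constants 8 and
   2 by 5/3, which stays below 14 and 4. *)
have eq5 : energy f / q <= energy f / 5.
  rewrite ler_wpM2l ?energy_ge0 // lef_pV2 ?posrE // ?ltr0n //.
  by rewrite (ler_nat R 5).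
have M0 : 0 <= (\sum_x psi x) * M.
  apply: mulr_ge0; first exact: sumr_ge0.
  apply: addr_ge0; apply: mulr_ge0; rewrite ?sqr_ge0 ?invr_ge0 ?(ltW q0) ?(ltW T_gt0) //.
  by apply: sumr_ge0 => x _; apply: sqr_ge0.
have S0 : 0 <= T * (\sum_x f x ^+ 2) ^+ 2 by rewrite mulr_ge0 ?sqr_ge0 // ltW.
rewrite E4 in split4; lra.
Qed.

End SphereEnergy.

(** * From the fourth moment of the extension to the energy *)

Section FourthMoment.
Variables (R : realType) (F : finFieldType) (chi : F -> R[i]).
Hypothesis chiD : forall x y, chi (x + y) = chi x * chi y.
Hypothesis chi0 : chi 0 = 1.
Hypothesis chi_neq1 : exists x, chi x != 1.
Local Notation q := (#|F|%:R : R).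
Variable d : nat.

Lemma cabsE (z : R[i]) : (cabs z)%:C%C = `|z|.
Proof. by rewrite normc_def. Qed.

Lemma cabs_ge0 (z : R[i]) : 0 <= cabs z.
Proof. exact: sqrtr_ge0. Qed.

Lemma cabsM (z w : R[i]) : cabs (z * w) = cabs z * cabs w.
Proof. by apply: (@complexI R); rewrite rmorphM /= !cabsE normrM. Qed.

Lemma ler_cabsD (z w : R[i]) : cabs (z + w) <= cabs z + cabs w.
Proof. by rewrite -lecR rmorphD /= !cabsE ler_normD. Qed.

Lemma cabs0 : cabs (0 : R[i]) = 0.
Proof. by apply: (@complexI R); rewrite cabsE normr0. Qed.

Lemma cabs_eq0 (z : R[i]) : (cabs z == 0) = (z == 0).
Proof. by rewrite -(fmorph_eq0 (real_complex R)) /= cabsE normr_eq0. Qed.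

(** Frequencies form a family with possible repetitions, so that pairs (x, y) can be indexed by x +
    y. *)
Lemma plancherel (I : finType) (s : I -> 'rV[F]_d) (a : I -> R[i]) :
  \sum_m `|\sum_i chi (dotF m (s i)) * a i| ^+ 2 =
  #|F|%:R ^+ d * \sum_i \sum_j a i * (a j)^* * (s i == s j)%:R.
Proof.
transitivity (\sum_m \sum_i \sum_j a i * (a j)^* * chi (dotF m (s i - s j))).
  apply: eq_bigr => m _; rewrite normCK rmorph_sum mulr_suml; apply: eq_bigr => i _.
  rewrite mulr_sumr; apply: eq_bigr => j _.
  by rewrite rmorphM /= (chi_conj chiD chi0) dotFDr chiD dotFNr; ring.
rewrite exchange_big mulr_sumr; apply: eq_bigr => i _ /=.
rewrite exchange_big mulr_sumr; apply: eq_bigr => j _ /=.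
by rewrite -mulr_sumr (sum_chi_dot chiD chi0 chi_neq1) subr_eq0; ring.
Qed.

(** The square of the sum is a character sum over pairs; Plancherel and the triangle inequality
    finish. *)
Lemma fourth_moment (a : 'rV[F]_d -> R[i]) :
  \sum_m cabs (\sum_x chi (dotF m x) * a x) ^+ 4 <= q ^+ d * energy (fun x => cabs (a x)).
Proof.
pose s (p : 'rV[F]_d * 'rV[F]_d) := p.1 + p.2.
pose b (p : 'rV[F]_d * 'rV[F]_d) := a p.1 * a p.2.
have sqrE m : (\sum_x chi (dotF m x) * a x) ^+ 2 = \sum_p chi (dotF m (s p)) * b p.
  rewrite -(pair_bigA _ (fun x y => chi (dotF m (x + y)) * (a x * a y))) /=.
  rewrite expr2 mulr_suml; apply: eq_bigr => x _; rewrite mulr_sumr.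
  by apply: eq_bigr => y _; rewrite dotFDr chiD; ring.
have -> : energy (fun x => cabs (a x)) =
    \sum_p \sum_r cabs (b p) * cabs (b r) * (s p == s r)%:R.
  rewrite -(pair_bigA _ (fun x y => \sum_r cabs (a x * a y) * cabs (b r) * (x + y == s r)%:R)).
  rewrite /energy [LHS]exchange_big; apply: eq_bigr => x _ /=.
  rewrite [LHS]exchange_big; apply: eq_bigr => y _ /=.
  transitivity (\sum_z \sum_w cabs (a x * a y) * cabs (a z * a w) * (x + y == z + w)%:R);
    last by rewrite pair_bigA.
  apply: eq_bigr => z _ /=.
  have wE w : (x + y == z + w) = (w == x + y - z) by rewrite [RHS]eq_sym subr_eq (addrC w).
  rewrite (bigD1 (x + y - z)) //= wE eqxx mulr1 !cabsM big1 ?addr0 // => w wz.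
  by rewrite wE (negbTE wz) mulr0.
rewrite -lecR rmorphM rmorphXn rmorph_nat.
have -> : (\sum_m cabs (\sum_x chi (dotF m x) * a x) ^+ 4)%:C%C =
    \sum_m `|\sum_p chi (dotF m (s p)) * b p| ^+ 2.
  rewrite rmorph_sum; apply: eq_bigr => m _.
  by rewrite rmorphXn /= cabsE -sqrE normrX -exprM.
have nonneg : 0 <= \sum_m `|\sum_p chi (dotF m (s p)) * b p| ^+ 2.
  by apply: sumr_ge0 => m _; rewrite exprn_ge0.
rewrite -(ger0_norm nonneg) plancherel normrM normrX normr_nat ler_wpM2l ?exprn_ge0 //.
apply: le_trans (ler_norm_sum _ _ _) _; rewrite rmorph_sum; apply: ler_sum => p _.
apply: le_trans (ler_norm_sum _ _ _) _; rewrite rmorph_sum; apply: ler_sum => r _.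
by rewrite !rmorphM rmorph_nat /= !cabsE !normrM !norm_conjC normr_nat.
Qed.

End FourthMoment.

(** * Inequalities between real powers *)

Section Powers.
Variable R : realType.
Implicit Types (a b c e p r l alpha : R).

(** In both cases (a/l)^(r-p) <= 1 for [a] positive. This trades exponents above or below a height
    [l]. *)
Lemma powR_le_scale a l p r : 0 < l -> 0 < p -> 0 < r -> 0 <= a ->
  (l <= a /\ r <= p) \/ (a <= l /\ p <= r) -> a `^ r <= l `^ (r - p) * a `^ p.
Proof.
move=> l0 p0 r0; rewrite le_eqVlt => /predU1P[<- _|a0 H].
  by rewrite !powR0 ?lt0r_neq0 // mulr0.
have -> : a `^ r = a `^ (r - p) * a `^ p.
  by rewrite -powRD ?subrK // (lt0r_neq0 a0) implybT.
rewrite ler_wpM2r ?powR_ge0 //; case: H => -[al pr].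
  rewrite -[r - p]opprB !powRN lef_pV2 ?posrE ?powR_gt0 //.
  by rewrite ge0_ler_powR ?subr_ge0 // nnegrE ltW.
by rewrite ge0_ler_powR ?subr_ge0 // nnegrE ltW.
Qed.

(** The smallest value is written as e^alpha e^alpha e^(1-2 alpha), and each factor is raised to the
    base [a], [b] or [c]. *)
Lemma mul_min_vertex alpha a b c e : 0 <= alpha -> 2 * alpha <= 1 ->
  0 <= e -> e <= a -> e <= b -> e <= c ->
  a * b * (c * e) <= a `^ (1 + alpha) * b `^ (1 + alpha) * c `^ (2 - 2 * alpha).
Proof.
move=> al0 al1; rewrite le_eqVlt => /predU1P[<- _ _ _|e0 ea eb ec].
  by rewrite !mulr0 !mulr_ge0 ?powR_ge0.
have [a0 [b0 c0]] : 0 < a /\ 0 < b /\ 0 < c by split; [|split]; apply: lt_le_trans e0 _.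
have powS x r : 0 < x -> x `^ (1 + r) = x * x `^ r.
  by move=> x0; rewrite powRD ?powRr1 ?(ltW x0) // (lt0r_neq0 x0) implybT.
have -> : 2 - 2 * alpha = 1 + (1 - 2 * alpha) by ring.
rewrite (powS a) // (powS b) // (powS c) //.
have -> : a * a `^ alpha * (b * b `^ alpha) * (c * c `^ (1 - 2 * alpha)) =
  a * b * (c * (a `^ alpha * b `^ alpha * c `^ (1 - 2 * alpha))) by ring.
rewrite !ler_wpM2l ?mulr_ge0 ?(ltW a0) ?(ltW b0) ?(ltW c0) //.
have -> : e = e `^ alpha * e `^ alpha * e `^ (1 - 2 * alpha).
  rewrite -!powRD ?(lt0r_neq0 e0) ?implybT // -[LHS]powRr1 ?(ltW e0) //.
  by congr (_ `^ _); ring.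
have mono x r : 0 <= r -> e <= x -> e `^ r <= x `^ r.
  by move=> r0 ex; rewrite ge0_ler_powR // nnegrE ?(ltW e0) // (le_trans (ltW e0)).
by rewrite !ler_pM ?mulr_ge0 ?powR_ge0 ?mono // subr_ge0.
Qed.

(** Whichever vertex is smallest is dropped: the other vertex of its diagonal takes the exponent 2 -
    2 alpha, and the opposite diagonal takes 1 + alpha. The four terms cover the four choices. *)
Lemma rectangle_powR alpha a b c e : 0 <= alpha -> 2 * alpha <= 1 ->
  0 <= a -> 0 <= b -> 0 <= c -> 0 <= e ->
  a * b * (c * e) <=
  a `^ (1 + alpha) * b `^ (1 + alpha) * c `^ (2 - 2 * alpha) +
  a `^ (1 + alpha) * b `^ (1 + alpha) * e `^ (2 - 2 * alpha) +
  (c `^ (1 + alpha) * e `^ (1 + alpha) * a `^ (2 - 2 * alpha) +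
   c `^ (1 + alpha) * e `^ (1 + alpha) * b `^ (2 - 2 * alpha)).
Proof.
move=> al0 al1 a0 b0 c0 e0.
pose phi x := x `^ (1 + alpha); pose psi x := x `^ (2 - 2 * alpha).
rewrite -!/(phi _) -!/(psi _).
have term0 x y z : 0 <= phi x * phi y * psi z by rewrite !mulr_ge0 ?powR_ge0.
have mv x y z w := @mul_min_vertex alpha x y z w al0 al1.
have t1 := term0 a b c; have t2 := term0 a b e; have t3 := term0 c e a; have t4 := term0 c e b.
have [ab|ba] := leP a b; have [ce|ec] := leP c e.
- have [ac|ca] := leP a c.
    have := mv c e b a a0 ac (le_trans ac ce) ab; rewrite -/(phi c) -/(phi e) -/(psi b); lra.
  have := mv a b e c c0 (ltW ca) (le_trans (ltW ca) ab) ce.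
  rewrite -/(phi a) -/(phi b) -/(psi e); lra.
- have [ae|ea] := leP a e.
    have := mv c e b a a0 (le_trans ae (ltW ec)) ae ab; rewrite -/(phi c) -/(phi e) -/(psi b); lra.
  have := mv a b c e e0 (ltW ea) (le_trans (ltW ea) ab) (ltW ec).
  rewrite -/(phi a) -/(phi b) -/(psi c); lra.
- have [bc|cb] := leP b c.
    have := mv c e a b b0 bc (le_trans bc ce) (ltW ba); rewrite -/(phi c) -/(phi e) -/(psi a); lra.
  have := mv a b e c c0 (le_trans (ltW cb) (ltW ba)) (ltW cb) ce.
  rewrite -/(phi a) -/(phi b) -/(psi e); lra.
- have [be|eb] := leP b e.
    have := mv c e a b b0 (le_trans be (ltW ec)) be (ltW ba).
    rewrite -/(phi c) -/(phi e) -/(psi a); lra.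
  have := mv a b c e e0 (le_trans (ltW eb) (ltW ba)) (ltW eb) (ltW ec).
  rewrite -/(phi a) -/(phi b) -/(psi c); lra.
Qed.

End Powers.

(** * Squares and nonsquares through the primitive element *)

Section PrimitiveRoot.
Variables (F : finFieldType) (g : F).
Hypothesis card_mod4 : (#|F| %% 4 = 1)%N.

Lemma card_ge5 : (5 <= #|F|)%N.
Proof. by move: (finNzRing_gt1 F) card_mod4; move: #|F| => n; lia. Qed.

Local Notation m := (#|F| %/ 4)%N.

Lemma pred_cardE : #|F|.-1 = (2 * (2 * m))%N.
Proof. by move: card_ge5 card_mod4; move: #|F| => n; lia. Qed.

Lemma quarter_gt0 : (0 < 2 * m)%N.
Proof. by move: card_ge5 card_mod4; move: #|F| => n; lia. Qed.

Hypothesis g_prim : (#|F|.-1).-primitive_root g.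

Lemma prim_pow_eq1 n : (g ^+ n == 1) = (2 * (2 * m) %| n)%N.
Proof. by rewrite -(prim_order_dvd g_prim) pred_cardE. Qed.

Lemma expf_pred_card (x : F) : x != 0 -> x ^+ #|F|.-1 = 1.
Proof.
move=> x0; apply: (mulfI x0).
by rewrite mulr1 -exprS prednK ?expf_card // ltnW // finNzRing_gt1.
Qed.

Lemma half_power : g ^+ (2 * m) != 1 /\ (g ^+ (2 * m)) ^+ 2 = 1.
Proof.
split; last by apply/eqP; rewrite -exprM prim_pow_eq1 mulnC.
rewrite prim_pow_eq1; apply/negP => /(dvdn_leq quarter_gt0).
by move: quarter_gt0; lia.
Qed.

(** In characteristic two, 1 is its own only square root, while g^((q-1)/2) is another one. *)
Lemma prim_two_neq0 : 2 != 0 :> F.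
Proof.
have [h1 h2] := half_power; apply: contraNneq h1 => two0.
rewrite -subr_eq0 -sqrf_eq0.
have -> : (g ^+ (2 * m) - 1) ^+ 2 = (g ^+ (2 * m)) ^+ 2 - 1 - 2 * (g ^+ (2 * m) - 1) by ring.
by rewrite h2 two0 mul0r subrr subr0.
Qed.

Lemma prim_sqrtN1 : exists i : F, i ^+ 2 = -1.
Proof.
have [h1 h2] := half_power; exists (g ^+ m); rewrite -exprM mulnC.
have /eqP := h2; rewrite -subr_eq0 subr_sqr_1 mulf_eq0 subr_eq0 (negbTE h1) addr_eq0.
by move/eqP.
Qed.

Lemma prim_neq0 : g != 0.
Proof.
apply/eqP => g0; have /eqP := prim_expr_order g_prim.
by rewrite g0 pred_cardE expr0n muln_eq0 /= eqn0Ngt quarter_gt0 eq_sym oner_eq0.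
Qed.

(** If g^n = x^2, raising to the power (q-1)/2 gives x^(q-1) = 1, so q - 1 divides n (q-1)/2. *)
Lemma prim_pow_sqr n : is_sqr (g ^+ n) = ~~ odd n.
Proof.
apply/existsP/idP => [[x /eqP x2]|even_n]; last first.
  by exists (g ^+ n./2); rewrite -exprM muln2 even_halfK.
have x0 : x != 0 by rewrite -sqrf_eq0 x2 expf_neq0 // prim_neq0.
rewrite -dvdn2 -(dvdn_pmul2r quarter_gt0) -prim_pow_eq1 exprM -x2 -exprM -pred_cardE.
by rewrite expf_pred_card.
Qed.

Lemma prim_nonsqr_mul (a b : F) : ~~ is_sqr a -> ~~ is_sqr b -> is_sqr (a * b).
Proof.
have pow (x : F) : ~~ is_sqr x -> exists n, x = g ^+ n.
  move=> xN; have x0 : x != 0.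
    by apply: contra xN => /eqP ->; apply/existsP; exists 0; rewrite expr0n.
  by have [i ->] := prim_rootP g_prim (expf_pred_card x0); exists i.
move=> aN bN; move: (aN) (bN); have [i ->] := pow a aN; have [j ->] := pow b bN.
by rewrite -exprD !prim_pow_sqr oddD => /negPn -> /negPn ->.
Qed.

Lemma prim_nonsqr : ~~ is_sqr g.
Proof. by rewrite -[g]expr1 prim_pow_sqr. Qed.

End PrimitiveRoot.

(** * Energy of the high and the low part of a function *)

(** Large values need no geometry: the energy is at most 4 times the cube of the sum of f^(4/3), and
    [l <= f] on the support with [4 / 3 <= p] turns this sum into that of f^p. *)
Lemma high_energy (R : realType) (V : finZmodType) (f : V -> R) (p l T : R) :
  4 / 3 <= p -> 0 < l -> (forall x, 0 <= f x) -> (forall x, f x != 0 -> l <= f x) ->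
  \sum_x f x `^ p <= T * l `^ p -> energy f <= 4 * (T ^+ 3 * l ^+ 4).
Proof.
move=> p43 l0 f0 fl fp.
have p0 : 0 < p by lra.
have T0 : 0 <= T.
  by rewrite -(pmulr_lge0 _ (powR_gt0 p l0)) (le_trans _ fp) // sumr_ge0 // => x _; exact: powR_ge0.
have f43 : \sum_x f x `^ (4 / 3) <= T * l `^ (4 / 3).
  apply: (@le_trans _ _ (l `^ (4 / 3 - p) * \sum_x f x `^ p)).
    rewrite mulr_sumr ler_sum // => x _.
    have [->|/fl fxl] := eqVneq (f x) 0; last by apply: powR_le_scale => //; lra.
    by rewrite powR0 ?mulr_ge0 ?powR_ge0 //; apply/eqP; lra.
  apply: le_trans (ler_wpM2l (powR_ge0 _ _) fp) _.
  by rewrite mulrCA -powRD ?subrK // (lt0r_neq0 l0) implybT.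
pose phi x := f x `^ (4 / 3).
have fP x y z w : f x * f y * (f z * f w) <=
    phi x * phi y * phi z + phi x * phi y * phi w +
    (phi z * phi w * phi x + phi z * phi w * phi y).
  (* At alpha = 1/3 the exponents 1 + alpha and 2 - 2 alpha coincide. *)
  have := @rectangle_powR R (1 / 3) (f x) (f y) (f z) (f w).
  have -> : 1 + 1 / 3 = 4 / 3 :> R by lra.
  have -> : 2 - 2 * (1 / 3) = 4 / 3 :> R by lra.
  by apply=> //; lra.
have := rectangle_sum (P := fun _ _ _ => true) (fun _ _ _ => erefl) (fun _ _ _ => erefl)
  (fun _ _ _ => erefl) fP.
have -> : \sum_z \sum_x \sum_y true%:R * (f x * f y * (f z * f (x + y - z))) = energy f.
  by do 3!(apply: eq_bigr => ? _); rewrite mul1r.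
move=> /le_trans; apply; rewrite ler_pM2l //.
have -> : \sum_z phi z * \sum_x \sum_y phi x * phi y * true%:R = (\sum_x phi x) ^+ 3.
  rewrite -mulr_suml exprS; congr (_ * _); rewrite expr2 mulr_suml.
  by apply: eq_bigr => x _; rewrite mulr_sumr; apply: eq_bigr => y _; rewrite mulr1.
have -> : T ^+ 3 * l ^+ 4 = (T * l `^ (4 / 3)) ^+ 3.
  rewrite exprMn -[X in _ = _ * X]powR_mulrn ?powR_ge0 // -powRrM.
  by rewrite -(powR_mulrn 4) ?(ltW l0) //; congr (_ * _ `^ _); lra.
by rewrite lerXn2r // nnegrE ?mulr_ge0 ?powR_ge0 // sumr_ge0 // => x _; exact: powR_ge0.
Qed.

Section LowEnergy.
Variables (R : realType) (F : finFieldType) (chi : F -> R[i]) (g : F).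
Hypothesis chiD : forall x y, chi (x + y) = chi x * chi y.
Hypothesis chi0 : chi 0 = 1.
Hypothesis chi_neq1 : exists x, chi x != 1.
Hypothesis card_mod4 : (#|F| %% 4 = 1)%N.
Hypothesis g_prim : (#|F|.-1).-primitive_root g.
Variable k : nat.
Hypothesis k_gt0 : (0 < k)%N.
Local Notation q := (#|F|%:R : R).
Local Notation d := (4 * k - 1)%N.
Local Notation S := (sphere d g).
Variable T : R.
Hypothesis T_gt0 : 0 < T.
Hypothesis T_sqr : T ^+ 2 * q ^+ 2 = q ^+ d.

(** Here [energy_bound] is used with psi = f^p. The exponents 2 and 4 - p of the diagonal terms are
    at least [p], so [f <= l] controls them; the main term is measured against [mu] instead. *)
Lemma low_energy (f : 'rV[F]_d -> R) (p l mu : R) :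
  4 / 3 <= p -> p <= 2 -> 0 < l -> 0 < mu ->
  (forall x, 0 <= f x) -> (forall x, f x != 0 -> x \in S) ->
  (forall x, f x <= l) -> \sum_x f x `^ p <= T * l `^ p ->
  \sum_x f x `^ p <= #|S|%:R * mu `^ p ->
  energy f <= 14 * (4 * (#|S|%:R ^+ 3 * mu ^+ 4 / q) + T ^+ 3 * l ^+ 4) +
              4 * (T ^+ 3 * l ^+ 4).
Proof.
move=> p43 p2 l0 mu0 f0 f_supp fl fpl fpmu.
have q0 : 0 < q by rewrite ltr0n ltnW // finNzRing_gt1.
have p0 : 0 < p by lra.
(* alpha = 1 - p/2 makes the exponent 2 - 2 alpha of [psi] equal to [p]; then p + 2s = 4. *)
pose s : R := 1 + (1 - p / 2).
have s0 : 0 < s by rewrite /s; lra.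
have alpha0 : 0 <= 1 - p / 2 by lra.
have alpha1 : 2 * (1 - p / 2) <= 1 by lra.
pose phi x := f x `^ s; pose psi x := f x `^ p.
have sphereE x : x \in S -> dotF x x = g by rewrite in_sphere => /eqP.
have powR_supp (r : R) x : r != 0 -> f x `^ r != 0 -> dotF x x = g.
  by move=> r0; rewrite powR_eq0 r0 andbT => /f_supp/sphereE.
have fP x y z w : f x * f y * (f z * f w) <=
    phi x * phi y * psi z + phi x * phi y * psi w +
    (phi z * phi w * psi x + phi z * phi w * psi y).
  have := rectangle_powR alpha0 alpha1 (f0 x) (f0 y) (f0 z) (f0 w).
  by have -> : 2 - 2 * (1 - p / 2) = p by field.
have := energy_bound chiD chi0 chi_neq1 (prim_two_neq0 card_mod4 g_prim)
  (prim_sqrtN1 card_mod4 g_prim) (prim_nonsqr_mul card_mod4 g_prim) (card_ge5 card_mod4)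
  k_gt0 T_gt0 T_sqr (prim_nonsqr card_mod4 g_prim) f0 (fun x => powR_ge0 _ _)
  (fun x => powR_ge0 _ _) (fun x fx => sphereE x (f_supp x fx))
  (fun x => powR_supp s x (lt0r_neq0 s0)) (fun x => powR_supp p x (lt0r_neq0 p0)) fP.
move=> /le_trans; apply.
have low r : p <= r -> \sum_x f x `^ r <= T * l `^ r.
  move=> pr; apply: (@le_trans _ _ (l `^ (r - p) * \sum_x f x `^ p)).
    rewrite mulr_sumr ler_sum // => x _; apply: powR_le_scale => //; first by lra.
    by right.
  apply: le_trans (ler_wpM2l (powR_ge0 _ _) fpl) _.
  by rewrite mulrCA -powRD ?subrK // (lt0r_neq0 l0) implybT.
(* Values up to [mu] are counted trivially on the sphere; above [mu], s <= p allows f^s to be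
   replaced by mu^(s-p) f^p. *)
have phi_sum : \sum_x phi x <= 2 * (#|S|%:R * mu `^ s).
  have pointwise x : phi x <= (x \in S)%:R * mu `^ s + mu `^ (s - p) * f x `^ p.
    have [fx0|/f_supp ->] := eqVneq (f x) 0.
      by rewrite /phi fx0 powR0 ?lt0r_neq0 // addr_ge0 ?mulr_ge0 ?powR_ge0 ?ler0n.
    rewrite mul1r; have [le_mu|lt_mu] := leP (f x) mu.
      rewrite -[leLHS]addr0 lerD ?mulr_ge0 ?powR_ge0 // ge0_ler_powR ?nnegrE ?f0 //.
        by rewrite ltW.
      by rewrite ltW.
    rewrite -[leLHS]add0r lerD ?powR_ge0 //; apply: powR_le_scale => //.
    by left; split; [exact: ltW|rewrite /s; lra].
  apply: le_trans (ler_sum _ (fun x _ => pointwise x)) _.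
  rewrite big_split /= -mulr_suml -mulr_sumr -natr_sum.
  have -> : (\sum_x (x \in S) = #|S|)%N by rewrite -sum1_card [RHS]big_mkcond.
  have := ler_wpM2l (powR_ge0 mu (s - p)) fpmu.
  by rewrite mulrCA -powRD ?subrK ?(lt0r_neq0 mu0) ?implybT //; lra.
have phi0 : 0 <= \sum_x phi x by apply: sumr_ge0 => x _; exact: powR_ge0.
have psi0 : 0 <= \sum_x psi x by apply: sumr_ge0 => x _; exact: powR_ge0.
have phi2_sum : \sum_x phi x ^+ 2 <= T * l `^ (2 * s).
  rewrite (eq_bigr (fun x => f x `^ (2 * s))); first by apply: low; rewrite /s; lra.
  by move=> x _; rewrite mulrC powRrM powR_mulrn ?powR_ge0.
have f2_sum : \sum_x f x ^+ 2 <= T * l ^+ 2.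
  rewrite -(powR_mulrn 2) ?(ltW l0) //.
  rewrite (eq_bigr (fun x => f x `^ 2)); first exact: low.
  by move=> x _; rewrite powR_mulrn.
have pow4 x : 0 < x -> x `^ p * x `^ (2 * s) = x ^+ 4.
  move=> x0; rewrite -powRD ?(lt0r_neq0 x0) ?implybT // -powR_mulrn ?(ltW x0) //.
  by congr (_ `^ _); rewrite /s; field.
rewrite lerD // ler_pM2l //; last first.
  have -> : T ^+ 3 * l ^+ 4 = T * (T * l ^+ 2) ^+ 2 by ring.
  rewrite ler_pM2l // lerXn2r // nnegrE ?mulr_ge0 ?exprn_ge0 ?(ltW T_gt0) ?(ltW l0) //.
  by apply: sumr_ge0 => x _; exact: sqr_ge0.
rewrite mulrDr lerD //.
  have -> : 4 * (#|S|%:R ^+ 3 * mu ^+ 4 / q) =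
      #|S|%:R * mu `^ p * ((2 * (#|S|%:R * mu `^ s)) ^+ 2 / q).
    have -> : mu ^+ 4 = mu `^ p * (mu `^ s) ^+ 2.
      by rewrite -pow4 // (mulrC 2) powRrM powR_mulrn ?powR_ge0.
    by field; rewrite lt0r_neq0.
  rewrite ler_pM ?mulr_ge0 ?invr_ge0 ?sqr_ge0 ?(ltW q0) //.
  by rewrite ler_pM2r ?invr_gt0 // lerXn2r // nnegrE ?mulr_ge0 ?powR_ge0.
have -> : T ^+ 3 * l ^+ 4 = T * l `^ p * (T * (T * l `^ (2 * s))).
  by rewrite -pow4 //; ring.
rewrite ler_pM ?ler_pM2l // mulr_ge0 ?(ltW T_gt0) // sumr_ge0 // => x _.
exact: sqr_ge0.
Qed.

End LowEnergy.

(* Since [p (3d - 2) = 4d], taking [d]-th powers leaves only integral powers. *)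
Lemma threshold_bound (R : realType) (d : nat) (p l mu n q T : R) :
  (1 <= d)%N -> p * (3 * d - 2)%:R = (4 * d)%:R ->
  0 < l -> 0 < mu -> 0 < n -> 0 < q -> 0 < T ->
  T * l `^ p = n * mu `^ p -> T ^+ 2 * q ^+ 2 = q ^+ d -> q ^+ d.-1 <= 2 * n ->
  q ^+ d * (T ^+ 3 * l ^+ 4) <= 8 * (n ^+ 4 * mu ^+ 4).
Proof.
move=> d1 pE l0 mu0 n0 q0 T0 lmu Tq qn.
have [ql nl Tl ll ml] : [/\ 0 <= q, 0 <= n, 0 <= T, 0 <= l & 0 <= mu] by split; exact: ltW.
have powE x : 0 < x -> (x `^ p) ^+ (3 * d - 2) = x ^+ (4 * d).
  by move=> x0; rewrite -powR_mulrn ?powR_ge0 // -powRrM pE powR_mulrn // ltW.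
rewrite -(ler_pXn2r (n := d)) ?nnegrE ?mulr_ge0 ?exprn_ge0 //.
have -> : (q ^+ d * (T ^+ 3 * l ^+ 4)) ^+ d =
    T ^+ 2 * q ^+ (d * d) * ((T * l `^ p) ^+ (3 * d - 2)).
  have eT : T ^+ (3 * d) = T ^+ 2 * T ^+ (3 * d - 2) by rewrite -exprD; congr (_ ^+ _); clear -d1; lia.
  by rewrite [(T * _) ^+ _]exprMn powE // exprMn exprMn -!exprM eT; ring.
(* The exponents agree: d - 2 + d^2 = (d - 1)(d + 2). *)
have -> : T ^+ 2 * q ^+ (d * d) = (q ^+ d.-1) ^+ (d + 2).
  apply: (mulIf (lt0r_neq0 (exprn_gt0 2 q0))).
  rewrite mulrAC Tq -exprM -!exprD; congr (_ ^+ _).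
  by clear -d1; case: d d1 => // m _ /=; nia.
rewrite lmu exprMn powE //.
have -> : (8 * (n ^+ 4 * mu ^+ 4)) ^+ d =
    8 ^+ d * n ^+ (d + 2) * (n ^+ (3 * d - 2) * mu ^+ (4 * d)).
  have en : n ^+ (4 * d) = n ^+ (d + 2) * n ^+ (3 * d - 2).
    by rewrite -exprD; congr (_ ^+ _); clear -d1; lia.
  by rewrite exprMn exprMn -!exprM en; ring.
rewrite ler_wpM2r ?mulr_ge0 ?exprn_ge0 //.
apply: (@le_trans _ _ ((2 * n) ^+ (d + 2))).
  by rewrite lerXn2r // nnegrE ?mulr_ge0 ?exprn_ge0 ?ltW.
rewrite exprMn ler_wpM2r ?exprn_ge0 //.
have -> : 8 = 2 ^+ 3 :> R by rewrite -natrX.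
rewrite -exprM ler_weXn2l ?ler1n //; clear -d1; lia.
Qed.

Lemma expr4D_le (R : realFieldType) (a b : R) : (a + b) ^+ 4 <= 8 * (a ^+ 4 + b ^+ 4).
Proof.
rewrite -subr_ge0.
have -> : 8 * (a ^+ 4 + b ^+ 4) - (a + b) ^+ 4 =
  (a - b) ^+ 2 * (5 * (a + b) ^+ 2 + 2 * a ^+ 2 + 2 * b ^+ 2) by ring.
apply: mulr_ge0; first exact: sqr_ge0.
have := sqr_ge0 (a + b); have := sqr_ge0 a; have := sqr_ge0 b; lra.
Qed.

(** The total is 22 QX + 56 QY, and 22 * 8 + 56 * 2 = 288. It serves with X = T^3 l^4, Y = |S|^3
    mu^4 / q, Z = |S|^4 mu^4 and Q = q^d. *)
Lemma energy_budget (R : realFieldType) (A B Q e1 e2 X Y Z : R) :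
  A <= Q * e1 -> B <= Q * e2 -> Q * e1 <= Q * (4 * X) ->
  Q * e2 <= Q * (14 * (4 * Y + X) + 4 * X) -> Q * X <= 8 * Z -> Q * Y <= 2 * Z ->
  A + B <= 288 * Z.
Proof. lra. Qed.

(** * The extension estimate for the sphere *)

Section SphereExtension.
Variables (R : realType) (F : finFieldType) (chi : F -> R[i]) (g : F).
Hypothesis chiD : forall x y, chi (x + y) = chi x * chi y.
Hypothesis chi0 : chi 0 = 1.
Hypothesis chi_neq1 : exists x, chi x != 1.
Hypothesis card_mod4 : (#|F| %% 4 = 1)%N.
Hypothesis g_prim : (#|F|.-1).-primitive_root g.
Variable k : nat.
Hypothesis k_gt0 : (0 < k)%N.
Local Notation q := (#|F|%:R : R).
Local Notation d := (4 * k - 1)%N.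
Local Notation S := (sphere d g).
Local Notation p := ((4 * d)%:R / (3 * d - 2)%:R : R).

(** The correction q^(2k-1) to the count is at most half of the main term, since d - 1 > 2k - 1 and
    q >= 5. *)
Lemma card_sphere_ge : q ^+ d.-1 <= 2 * #|S|%:R.
Proof.
have q5 : 5 <= q by rewrite (ler_nat R 5) card_ge5.
have SE : #|S|%:R = q ^+ d.-1 - q ^+ (2 * k - 1).
  apply: (@complexI R); rewrite rmorphB !rmorphXn !rmorph_nat.
  exact: (card_sphere chiD chi0 chi_neq1 (prim_two_neq0 card_mod4 g_prim)
    (prim_sqrtN1 card_mod4 g_prim) k_gt0 (prim_nonsqr card_mod4 g_prim)).
have : 2 * q ^+ (2 * k - 1) <= q ^+ d.-1.
  have -> : d.-1 = (2 * k - 2 + (2 * k - 1)).+1 by lia.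
  rewrite exprS ler_pM ?exprn_ge0 ?ler0n //; first by lra.
  by rewrite ler_weXn2l; [|lra|lia].
rewrite SE; lra.
Qed.

(** [f] is cut at the height [l]: the part above goes through [high_energy], the part below through
    [low_energy], and [threshold_bound] compares [l] with the norm [mu]. *)
Lemma sphere_extension : extension_bound chi S p 4 7.
Proof.
move=> f.
have q0 : 0 < q by rewrite ltr0n ltnW // finNzRing_gt1.
have n0 : 0 < #|S|%:R :> R.
  have := card_sphere_ge; have := exprn_gt0 d.-1 q0; lra.
have d3 : (3 <= d)%N by lia.
have pE : p * (3 * d - 2)%:R = (4 * d)%:R.
  by rewrite divfK // pnatr_eq0; lia.
have [p43 p2] : 4 / 3 <= p /\ p <= 2.
  have c0 : 0 < (3 * d - 2)%:R :> R by rewrite ltr0n; lia.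
  rewrite ler_pdivlMr // ler_pdivrMr //.
  have -> : (3 * d - 2)%:R = 3 * d%:R - 2 :> R by rewrite natrB ?natrM //; lia.
  have : 3 <= d%:R :> R by rewrite (ler_nat R 3).
  rewrite natrM; lra.
have p0 : 0 < p by lra.
set mu := norm_dsigma p S f.
have mu_ge0 : 0 <= mu by exact: powR_ge0.
suff bound : \sum_m cabs (ext_op chi S f m) ^+ 4 <= (7 * mu) ^+ 4.
  rewrite /norm_dc; under eq_bigr do rewrite (powR_mulrn 4) ?cabs_ge0 //.
  have sum0 : 0 <= \sum_m cabs (ext_op chi S f m) ^+ 4.
    by apply: sumr_ge0 => m _; rewrite exprn_ge0 // cabs_ge0.
  have -> : 7 * mu = ((7 * mu) ^+ 4) `^ 4^-1.
    by rewrite -powR_mulrn ?mulr_ge0 // -powRrM divff ?powRr1 ?mulr_ge0 //.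
  by rewrite ge0_ler_powR ?nnegrE ?invr_ge0 ?exprn_ge0 ?mulr_ge0.
set N := \sum_(x in S) cabs (f x) `^ p.
have N_ge0 : 0 <= N by apply: sumr_ge0 => x _; exact: powR_ge0.
(* For N = 0 the height [l] would be 0; then [f] vanishes on the sphere. *)
have [N0|N_neq0] := eqVneq N 0.
  have f0 x : x \in S -> f x = 0.
    move=> xS; apply/eqP; rewrite -cabs_eq0.
    have /eqP := N0; rewrite psumr_eq0 => [/allP /(_ x)|y _]; last exact: powR_ge0.
    by rewrite mem_index_enum xS powR_eq0 (lt0r_neq0 p0) andbT; apply.
  rewrite big1 ?exprn_ge0 ?mulr_ge0 // => m _.
  by rewrite /ext_op big1 ?mulr0 ?cabs0 ?expr0n // => x /f0 ->; rewrite mulr0.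
have N_gt0 : 0 < N by rewrite lt0r N_neq0.
(* A square root is taken because d - 2 is odd. *)
pose T := Num.sqrt (q ^+ (d - 2)).
have T0 : 0 < T by rewrite sqrtr_gt0 exprn_gt0.
have T_sqr : T ^+ 2 * q ^+ 2 = q ^+ d.
  rewrite sqr_sqrtr ?exprn_ge0 ?(ltW q0) // -exprD; congr (_ ^+ _).
  by clear -d3; lia.
(* This height solves T l^p = N, just as [mu] solves |S| mu^p = N. *)
pose l := (N / T) `^ p^-1.
have l0 : 0 < l by rewrite powR_gt0 // divr_gt0.
have mu0 : 0 < mu by rewrite powR_gt0 // mulr_gt0 ?invr_gt0.
have powVK y : 0 <= y -> (y `^ p^-1) `^ p = y.
  by move=> y0; rewrite -powRrM mulVf ?powRr1 ?(lt0r_neq0 p0).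
have lE : T * l `^ p = N.
  by rewrite powVK ?divr_ge0 ?(ltW T0) // mulrC divfK ?lt0r_neq0.
have muE : #|S|%:R * mu `^ p = N.
  by rewrite powVK ?mulr_ge0 ?invr_ge0 // mulrA divff ?mul1r ?lt0r_neq0.
pose part (P : pred R) x := if (x \in S) && P (cabs (f x)) then f x else 0.
have part_sum P : \sum_x cabs (part P x) `^ p <= N.
  rewrite /N [leRHS]big_mkcond; apply: ler_sum => x _; rewrite /part.
  case: (x \in S); case: (P _) => //=; rewrite cabs0 powR0 ?lt0r_neq0 ?powR_ge0 //.
have part_supp P x : cabs (part P x) != 0 -> x \in S.
  by rewrite cabs_eq0 /part; case: (x \in S); rewrite ?eqxx.
pose big := [pred a : R | l < a].
pose small := [pred a : R | a <= l].
have big_energy : energy (fun x => cabs (part big x)) <= 4 * (T ^+ 3 * l ^+ 4).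
  apply: (high_energy p43 l0) => [x|x|]; rewrite ?cabs_ge0 //; last by rewrite lE.
  rewrite cabs_eq0 /part; case: ifP => [/andP[_ /ltW]//|_]; by rewrite eqxx.
have small_energy := low_energy chiD chi0 chi_neq1 card_mod4 g_prim k_gt0 T0 T_sqr p43 p2 l0 mu0
  (fun x => cabs_ge0 (part small x)) (part_supp small).
have {}small_energy : energy (fun x => cabs (part small x)) <=
    14 * (4 * (#|S|%:R ^+ 3 * mu ^+ 4 / q) + T ^+ 3 * l ^+ 4) + 4 * (T ^+ 3 * l ^+ 4).
  apply: small_energy; rewrite ?lE ?muE // => x.
  by rewrite /part; case: ifP => [/andP[]//|_]; rewrite cabs0 ltW.
pose H P m := \sum_x chi (dotF m x) * part P x.
have extE m : ext_op chi S f m = (#|S|%:R)^-1 * (H big m + H small m).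
  rewrite /ext_op -big_split big_mkcond; congr (_ * _); apply: eq_bigr => x _ /=.
  rewrite /part; case: (x \in S) => /=; last by rewrite mulr0 addr0.
  by case: leP => _; rewrite mulr0 ?addr0 ?add0r.
have cabs_ext m : cabs (ext_op chi S f m) ^+ 4 <=
    8 / #|S|%:R ^+ 4 * (cabs (H big m) ^+ 4 + cabs (H small m) ^+ 4).
  rewrite extE cabsM (_ : cabs _ = #|S|%:R^-1); last first.
    by apply: (@complexI R); rewrite cabsE fmorphV rmorph_nat normfV normr_nat.
  rewrite exprMn exprVn (mulrC 8) -mulrA ler_pM2l ?invr_gt0 ?exprn_gt0 //.
  apply: (@le_trans _ _ ((cabs (H big m) + cabs (H small m)) ^+ 4)).
    by rewrite lerXn2r ?nnegrE ?addr_ge0 ?cabs_ge0 // ler_cabsD.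
  exact: expr4D_le.
apply: le_trans (ler_sum _ (fun m _ => cabs_ext m)) _.
rewrite -mulr_sumr big_split /=.
have bigM := fourth_moment chiD chi0 chi_neq1 (part big).
have smallM := fourth_moment chiD chi0 chi_neq1 (part small).
have thr := threshold_bound (ltnW (ltnW d3)) pE l0 mu0 n0 q0 T0 (etrans lE (esym muE)) T_sqr card_sphere_ge.
have vol : q ^+ d * (#|S|%:R ^+ 3 * mu ^+ 4 / q) <= 2 * (#|S|%:R ^+ 4 * mu ^+ 4).
  have -> : q ^+ d * (#|S|%:R ^+ 3 * mu ^+ 4 / q) = q ^+ d.-1 * (#|S|%:R ^+ 3 * mu ^+ 4).
    rewrite (_ : q ^+ d = q * q ^+ d.-1); last by rewrite -exprS prednK // ltnW // ltnW.
    by field; rewrite lt0r_neq0.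
  have -> : 2 * (#|S|%:R ^+ 4 * mu ^+ 4) = 2 * #|S|%:R * (#|S|%:R ^+ 3 * mu ^+ 4) by ring.
  by rewrite ler_wpM2r ?card_sphere_ge // mulr_ge0 ?exprn_ge0.
have qd0 : 0 <= q ^+ d by rewrite exprn_ge0 ?ltW.
have big_energy' := ler_wpM2l qd0 big_energy.
have small_energy' := ler_wpM2l qd0 small_energy.
apply: (@le_trans _ _ (8 / #|S|%:R ^+ 4 * (288 * (#|S|%:R ^+ 4 * mu ^+ 4)))).
  rewrite ler_wpM2l ?divr_ge0 ?exprn_ge0 //.
  exact: energy_budget bigM smallM big_energy' small_energy' thr vol.
have -> : 8 / #|S|%:R ^+ 4 * (288 * (#|S|%:R ^+ 4 * mu ^+ 4)) = 2304 * mu ^+ 4.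
  by field; rewrite lt0r_neq0.
(* The constant 7 is the least integer that works here: 7^4 = 2401 exceeds 8 * 288 = 2304. *)
rewrite exprMn ler_wpM2r ?exprn_ge0 // -natrX ler_nat //.
Qed.

End SphereExtension.
Unset Implicit Arguments.

Theorem theorem1p11 (R : realType) (k : nat) (hk : (0 < k)%N) :
  exists C : R, forall (F : finFieldType) (chi : F -> R[i]) (g : F),
    odd #|F| -> (#|F| %% 4 = 1)%N ->
    (#|F|.-1).-primitive_root g ->
    nontrivial_additive_character chi ->
    let d := (4 * k - 1)%N in
    extension_bound chi (sphere d g)
      ((4 * d)%:R / (3 * d - 2)%:R) 4 C.
Proof.
exists 7 => F chi g _ card_mod4 g_prim [chiD chi_neq1] d.
have : chi 0 * (chi 0 - 1) == 0 by rewrite mulrBr mulr1 -chiD addr0 subrr.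
(* The zero function is multiplicative and not constantly 1, so it has to be
   dealt with separately. *)
rewrite mulf_eq0 subr_eq0 => /predU1P[chi00|/eqP chi0]; last exact: sphere_extension.
move=> f; rewrite /norm_dc big1 => [|m _].
  by rewrite powR0 ?invr_eq0 ?pnatr_eq0 // mulr_ge0 ?powR_ge0.
rewrite /ext_op big1 => [|x _]; first by rewrite mulr0 cabs0 powR0 ?pnatr_eq0.
by rewrite -(addr0 (dotF m x)) chiD chi00 mulr0 mul0r.
Qed.
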